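(* Every $FP_{loc}$ formula $\mu(\varphi^{(k)}(T)(x,\bar y))$ can be evaluated on $k$-locally consistent networks with complexity: IN-TIME/ROUND $=O(1)$, DIST-TIME $=O(n)$, MSG-SIZE $=O(1)$, $\#$MSG/NODE $=O(1)$.
   Context: A $k$-locally consistent network is a finite, connected, undirected graph $(V,G)$ of degree bounded by a constant $D$, with $n=|V|$ and diameter $\Delta$, together with a labeling $L:V\to C$ such that for every node $a$ and all distinct $b_1,b_2\in\mathcal{N}^k(a)$, $L(b_1)\neq L(b_2)$. Here $\mathcal{N}^k(a)$ is the set of nodes at distance at most $k$ from $a$. The model is synchronous message passing. Each node knows its own label and those of its neighbours; a query is posed by a requesting node. Complexity measures: IN-TIME/ROUND is the maximal in-node computation time in one round; DIST-TIME is the maximal number of rounds until termination; MSG-SIZE is the maximal number of bits of a message; $\#$MSG/NODE is the maximal number of messages sent by a node. Bounds are in terms of $n$ and $\Delta$, with the formula, $k$ and $D$ fixed. $FP_{loc}$ is the set of fixpoint formulas $\mu(\varphi^{(k)}(T)(x,\bar y))$ with $\bar y=y_1\dots y_\ell$, where $T$ is of arity $\ell+1$ and $\varphi^{(k)}(T)$ is a first-order formula over $\{G,T\}$ with all quantifiers relativized to $\mathcal{N}^k(x)$ and $y\in\mathcal{N}^k(x)$ required for each free variable $y$ in $\bar y$. The formula denotes the inflationary fixpoint $I_0=\emptyset$, $I_{i+1}=\varphi^{(k)}(I_i)\cup I_i$. Evaluation means that each node $a$ obtains the fixpoint tuples with first component $a$.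
   Formalization: The label set C is taken to be a fixed finite set, and the O(1) and O(n) constants may depend on it as well as on the formula, k and D; with unboundedly many labels, messages of O(1) bits could not carry the labels of nodes at distance 2. *)

(* Defs.v *)
From mathcomp Require Import all_boot.

Set Implicit Arguments.
Unset Strict Implicit.
Unset Printing Implicit Defensive.

(** * Networks *)

(* The nodes at distance at most k from a. *)
Definition ball (V : finType) (G : rel V) (k : nat) (a : V) : {set V} :=
  [set b | [exists m : 'I_k.+1, exists p : m.-tuple V,
              path G a p && (last a p == b)]].

Record network (C : finType) (k D : nat) := Network {
  node :> finType;
  adj : rel node;
  label : node -> C;
  adj_sym : symmetric adj;
  adj_irr : irreflexive adj;
  adj_connected : forall a b, connect adj a b;
  adj_degree : forall a, #|[set b | adj a b]| <= D;
  label_consistent : forall a b1 b2,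
    b1 \in ball adj k a -> b2 \in ball adj k a -> b1 <> b2 ->
    label b1 <> label b2 }.

(* Each node accesses its incident links through local ports; the numbering of
   the ports is arbitrary, and unrelated at the two ends of a link. *)
Record port_numbering (C : finType) (k D : nat) (N : network C k D) := Ports {
  port : N -> 'I_D -> option N;
  port_adj : forall a b, adj a b = [exists i, port a i == Some b];
  port_inj : forall a i j b, port a i = Some b -> port a j = Some b -> i = j }.

(** * Local fixpoint formulas *)

(* First-order formulas over a binary symbol G and a symbol T of arity l + 1,
   with free variables in X; a quantifier binds the variable None of
   option X. *)
Inductive formula (l : nat) (X : Type) : Type :=
| FEq of X & X
| FG of X & X
| FT of X & l.-tuple X
| FNot of formula l X
| FAnd of formula l X & formula l X
| FOr of formula l X & formula l X
| FEx of formula l (option X)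
| FAll of formula l (option X).

Definition extend (V X : Type) (e : X -> V) (v : V) (x : option X) : V :=
  if x is Some y then e y else v.

(* Satisfaction with all quantifiers relativized to U. *)
Fixpoint sat (V : finType) (G : rel V) (U : {set V}) (l : nat)
    (T : {set V * l.-tuple V}) (X : Type) (f : formula l X) {struct f} :
    (X -> V) -> bool :=
  match f with
  | FEq x y => fun e => e x == e y
  | FG x y => fun e => G (e x) (e y)
  | FT x ys => fun e => (e x, map_tuple e ys) \in T
  | FNot f => fun e => ~~ sat G U T f e
  | FAnd f g => fun e => sat G U T f e && sat G U T g e
  | FOr f g => fun e => sat G U T f e || sat G U T g e
  | FEx f => fun e => [exists v in U, sat G U T f (extend e v)]
  | FAll f => fun e => [forall v in U, sat G U T f (extend e v)]
  end.

(* The operator T |-> phi^(k)(T)(x, y_1 ... y_l); the free variable None of phi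
   is x, and Some i is y_i. *)
Definition local_op (V : finType) (G : rel V) (k l : nat)
    (phi : formula l (option 'I_l)) (T : {set V * l.-tuple V}) :
    {set V * l.-tuple V} :=
  [set t : V * l.-tuple V |
     all (fun b => b \in ball G k t.1) t.2
     && sat G (ball G k t.1) T phi (extend (tnth t.2) t.1)].

Fixpoint stage (V : finType) (G : rel V) (k l : nat)
    (phi : formula l (option 'I_l)) (i : nat) : {set V * l.-tuple V} :=
  if i is i'.+1 then
    local_op G k phi (stage G k phi i') :|: stage G k phi i'
  else set0.

Definition in_fixpoint (V : finType) (G : rel V) (k l : nat)
    (phi : formula l (option 'I_l)) (t : V * l.-tuple V) : Prop :=
  exists i, t \in stage G k phi i.

(** * In-node computation: multitape Turing machines *)

Inductive move := MoveL | Stay | MoveR.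

(* A two-way infinite tape; None is the blank, and the cells beyond those
   listed on either side are blank. The left part is listed from the head
   outwards. *)
Record tape (A : Type) := Tape {
  tape_left : seq (option A);
  tape_head : option A;
  tape_right : seq (option A) }.

Definition blank_tape (A : Type) : tape A := Tape [::] None [::].

Definition tape_act (A : Type) (w : option A) (m : move) (t : tape A) : tape A :=
  match m with
  | MoveL => Tape (behead (tape_left t)) (head None (tape_left t))
                  (w :: tape_right t)
  | Stay => Tape (tape_left t) w (tape_right t)
  | MoveR => Tape (w :: tape_left t) (head None (tape_right t))
                  (behead (tape_right t))
  end.

(* One elementary step: next control state, symbol written on the work tape and
   move of its head, ports whose (one-way, read-only) input head advances, bit
   appended to the outgoing message of each port, tuple of labels appended to
   the answer. *)
Record action (Q W C : finType) (D l : nat) := Action {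
  act_state : Q;
  act_write : option W;
  act_move : move;
  act_read : {set 'I_D};
  act_send : {ffun 'I_D -> option bool};
  act_answer : option (l.-tuple C) }.

(* The initial control state records what a node knows beforehand: its own
   label, the label of its neighbour at each port, and whether it is the
   requesting node. A step depends on the control state, the symbol under the
   work head and the symbols under the input heads, hence on a finite table. *)
Record machine (C : finType) (D l : nat) := Machine {
  control : finType;
  work : finType;
  init : C -> {ffun 'I_D -> option C} -> bool -> control;
  pausing : pred control;
  halting : pred control;
  delta : control -> option work -> {ffun 'I_D -> option bool} ->
          action control work C D l }.

Record conf (C : finType) (D l : nat) (M : machine C D l) := Conf {
  state : control M;
  memory : tape (work M);
  inbox : {ffun 'I_D -> seq bool};
  outbox : {ffun 'I_D -> seq bool};
  answer : seq (l.-tuple C) }.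

Definition step (C : finType) (D l : nat) (M : machine C D l) (x : conf M) :
    conf M :=
  let a := delta (state x) (tape_head (memory x))
                 [ffun i => ohead (inbox x i)] in
  Conf (act_state a)
       (tape_act (act_write a) (act_move a) (memory x))
       [ffun i => if i \in act_read a then behead (inbox x i) else inbox x i]
       [ffun i => if act_send a i is Some b then rcons (outbox x i) b
                  else outbox x i]
       (if act_answer a is Some c then rcons (answer x) c else answer x).

Definition halted (C : finType) (D l : nat) (M : machine C D l) (x : conf M) :
    bool := halting (state x).

Definition stopped (C : finType) (D l : nat) (M : machine C D l) (x : conf M) :
    bool := pausing (state x) || halted x.

(* The computation of one round, in s steps: it performs at least one step and
   ends the first time that the machine pauses or halts. *)
Definition computes_in (C : finType) (D l : nat) (M : machine C D l)
    (x y : conf M) (s : nat) : Prop :=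
  [/\ 0 < s, iter s (@step C D l M) x = y, stopped y
    & forall j, 0 < j < s -> ~~ stopped (iter j (@step C D l M) x)].

(** * Synchronous executions *)

(* A message is a nonempty bit string; [::] means that no message is sent. *)
Definition no_mail (D : nat) : {ffun 'I_D -> seq bool} := [ffun=> [::]].

Definition load (C : finType) (D l : nat) (M : machine C D l) (x : conf M)
    (m : {ffun 'I_D -> seq bool}) : conf M :=
  Conf (state x) (memory x) m (no_mail D) (answer x).

Definition start (C : finType) (k D l : nat) (N : network C k D)
    (P : port_numbering N) (M : machine C D l) (r a : N) : conf M :=
  Conf (init M (label a) [ffun i => omap (@label C k D N) (port P a i)] (a == r))
       (blank_tape (work M)) (no_mail D) (no_mail D) [::].

(* The messages that reach a, port by port, when x gives the configurations of
   the nodes at the end of the previous round. *)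
Definition mail (C : finType) (k D l : nat) (N : network C k D)
    (P : port_numbering N) (M : machine C D l) (x : N -> conf M) (a : N) :
    {ffun 'I_D -> seq bool} :=
  [ffun i => if port P a i is Some b then
               if [pick j | port P b j == Some a] is Some j
               then outbox (x b) j else [::]
             else [::]].

(* Only the requesting node r starts spontaneously; another node stays passive
   until the first round in which a message reaches it. *)
Definition awake (C : finType) (k D l : nat) (N : network C k D)
    (P : port_numbering N) (M : machine C D l) (r : N)
    (x : nat -> N -> conf M) (t : nat) (a : N) : bool :=
  (a == r) || [exists s : 'I_t.+1, mail P (x s) a != no_mail D].

(* x t a is the configuration of a after t rounds, and steps t a the number of
   steps that a performs in the round from x t to x t.+1. Machines being
   deterministic, there is at most one execution for given M, P and r. *)
Definition execution (C : finType) (k D l : nat) (N : network C k D)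
    (P : port_numbering N) (M : machine C D l) (r : N)
    (x : nat -> N -> conf M) (steps : nat -> N -> nat) : Prop :=
  (forall a, x 0 a = start P M r a) /\
  (forall t a,
     if awake P r x t a && ~~ halted (x t a)
     then computes_in (load (x t a) (mail P (x t) a)) (x t.+1 a) (steps t a)
     else x t.+1 a = load (x t a) (no_mail D) /\ steps t a = 0).

Definition messages_sent (C : finType) (D l : nat) (V : finType)
    (M : machine C D l) (x : nat -> V -> conf M) (T : nat) (a : V) : nat :=
  \sum_(t < T) \sum_(i < D) (outbox (x t.+1 a) i != [::]).

(* The nodes of the ball around a have distinct labels, so tuples of such nodes
   are represented by the tuples of their labels. *)
Definition correct_answer (C : finType) (k D l : nat) (N : network C k D)
    (phi : formula l (option 'I_l)) (M : machine C D l) (a : N) (y : conf M) :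
    Prop :=
  forall c : l.-tuple C,
    c \in answer y <->
    exists b : l.-tuple N,
      in_fixpoint (@adj C k D N) k phi (a, b)
      /\ map_tuple (@label C k D N) b = c.

(* Main.v *)
From HB Require Import structures.
Require Import Defs.
From mathcomp Require Import all_boot zify.

Set Implicit Arguments.
Unset Strict Implicit.
Unset Printing Implicit Defensive.

(** Labels that are distinct in every ball of radius k do not determine the
    balls: a hexagon labelled 1 2 3 1 2 3 looks locally like a triangle.  The
    requesting node breaks this symmetry.  It sends a token around the network
    by Tarry's traversal (each link is used once in each direction, and the link
    to the parent last).  The holder v floods an activation to distance k, each
    b that hears it floods its label to distance k, each c that hears b floods
    the pair (b, c) to distance k, and v records the pairs that come back.  As
    the token is unique and stays longer than all this takes, v learns exactly
    which nodes of its ball are adjacent or within distance k of each other.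

    Then the root floods a start signal and every node evaluates one stage each
    2k + 1 rounds, counted from its own start, flooding only its new tuples to
    distance k.  Starting times of nodes at distance j differ by at most j, so
    the tuples of a stage arrive after the evaluation of that stage and before
    the next one; silence means that nothing changed.  There are at most
    n |C|^l nontrivial stages, and a second traversal by a token that rests long
    enough at each node outlasts them; then the root floods a halt signal.

    Each node belongs to boundedly many balls, holds the token boundedly often
    and discovers boundedly many tuples, hence sends O(1) messages; the state of
    a node is finite, and the work tape is not needed. *)

(** * Finite-state protocols and their machines *)

(* The empty set of items stands for the absence of a message. *)
Record protocol (C : finType) (D l : nat) := Protocol {
  pstate : finType;
  pitem : finType;
  pinit : C -> {ffun 'I_D -> option C} -> bool -> pstate;
  pstep : pstate -> {ffun 'I_D -> {set pitem}} ->
          pstate * {ffun 'I_D -> {set pitem}};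
  phalt : pred pstate;
  pans : pstate -> {set l.-tuple C} }.

Definition quiet (D : nat) (F : finType) : {ffun 'I_D -> {set F}} :=
  [ffun=> set0].

Section Run.

Variables (C : finType) (k D l : nat) (N : network C k D).
Variables (P : port_numbering N) (A : protocol C D l) (r : N).

Notation pconf := (pstate A * {ffun 'I_D -> {set pitem A}})%type.

Definition pmail (x : N -> pconf) (a : N) : {ffun 'I_D -> {set pitem A}} :=
  [ffun i => if port P a i is Some b then
               if [pick j | port P b j == Some a] is Some j
               then (x b).2 j else set0
             else set0].

Definition pround (x : N -> pconf) (a : N) : pconf :=
  if phalt (x a).1 then ((x a).1, quiet D _) else pstep (x a).1 (pmail x a).

Definition pstart (a : N) : pstate A :=
  pinit A (label a) [ffun i => omap (@label C k D N) (port P a i)] (a == r).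

Fixpoint prun (t : nat) : N -> pconf :=
  if t is t'.+1 then pround (prun t') else fun a => (pstart a, quiet D _).

End Run.

(** * Compilation of a protocol into a Turing machine *)

Section Compile.

Variables (C : finType) (D l : nat) (A : protocol C D l).
Notation F := (pitem A).
Notation L := #|F|.
Notation Z := #|{: l.-tuple C}|.
Notation last_phase := (L.*2 + Z).+1.

(** A nonempty set is sent as its characteristic vector along [enum F], so that all messages have
    length [L]. The empty set needs a case of its own, since an all-false vector would still count
    as a message. *)
Definition bits (m : {set F}) : seq bool :=
  if m == set0 then [::] else [seq f \in m | f <- enum F].

Definition ccontrol : finType :=
  (pstate A * {ffun 'I_D -> {set F}} * 'I_last_phase.+1)%type.

(* Phases: 0 .. L-1 read the incoming items bit by bit, L applies the protocol
   step, L+1 .. 2L write the outgoing items, 2L+1 .. 2L+Z enumerate the possible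
   answers, and the last phase empties the buffer and stops. *)
Definition cdelta (c : ccontrol) (_ : option unit)
    (b : {ffun 'I_D -> option bool}) : action ccontrol unit C D l :=
  let: (s, buf, p) := c in
  let go c' := @Action ccontrol unit C D l c' None Stay in
  if p < L then
    go (s, [ffun i => if b i == Some true
                      then buf i :|: [set f | enum_rank f == p :> nat]
                      else buf i], inord p.+1) setT [ffun=> None] None
  else if p == L :> nat then
    go (pstep s buf, inord p.+1) set0 [ffun=> None] None
  else if p <= L.*2 then
    go (s, buf, inord p.+1) set0
      [ffun i => if buf i == set0 then None
                 else Some [exists f in buf i, L.+1 + enum_rank f == p]] None
  else if p <= L.*2 + Z then
    go (s, buf, inord p.+1) set0 [ffun=> None]
      (if phalt s
       then [pick c in pans s | L.*2.+1 + enum_rank c == p] else None)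
  else go (s, quiet D F, ord0) set0 [ffun=> None] None.

(** A round both begins and ends in phase 0; as it must perform at least one step, it runs through
    the whole cycle of phases. Halting is tested in phase 0 only, so the answers are written before
    the machine counts as halted. *)
Definition compiled : machine C D l :=
  @Machine C D l ccontrol unit
    (fun c nb b => (pinit A c nb b, quiet D F, ord0))
    (fun c => c.2 == ord0) (fun c => (c.2 == ord0) && phalt c.1.1) cdelta.

Notation cstep := (@step C D l compiled).

Definition cconf (s : pstate A) (buf : {ffun 'I_D -> {set F}}) (p : nat)
    (ib ob : {ffun 'I_D -> seq bool}) (an : seq (l.-tuple C)) : conf compiled :=
  @Conf C D l compiled ((s, buf, inord p) : ccontrol) (blank_tape unit) ib ob an.

Lemma conf_eq (x y : conf compiled) :
  state x = state y -> memory x = memory y -> inbox x = inbox y ->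
  outbox x = outbox y -> answer x = answer y -> x = y.
Proof. by case: x y => [? ? ? ? ?] [? ? ? ? ?] /= -> -> -> -> ->. Qed.

Lemma inord_phase p : p <= last_phase -> (inord p : 'I_last_phase.+1) = p :> nat.
Proof. by move=> hp; rewrite inordK. Qed.

Lemma size_bits m : size (bits m) <= L.
Proof. by rewrite /bits; case: ifP; rewrite // size_map -cardE. Qed.

Lemma bits_nil m : (bits m != [::]) = (m != set0).
Proof.
rewrite /bits; have [_|/set0Pn[f _]] := eqVneq m set0 => //.
by rewrite -size_eq0 size_map -cardE -lt0n; apply/card_gt0P; exists f.
Qed.

Lemma ohead_drop (T : Type) (x0 : T) s p :
  p < size s -> ohead (drop p s) = Some (nth x0 s p).
Proof. by move=> hp; rewrite (drop_nth x0 hp). Qed.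

(** This includes the empty message: its input head sees a blank, which is read like the bit
    false. *)
Lemma drop_bits p m : p < L ->
  (ohead (drop p (bits m)) == Some true)
  = [exists f in m, enum_rank f == p :> nat].
Proof.
move=> hp; rewrite /bits; have [->|nz] := eqVneq m set0.
  by rewrite /=; apply/esym/existsP => -[f]; rewrite inE.
have hs : p < size (enum F) by rewrite -cardE.
have hm : p < size [seq f \in m | f <- enum F] by rewrite size_map.
rewrite (ohead_drop false hm).
have f0 := enum_val (Ordinal hp).
rewrite (nth_map f0) //; set g := nth _ _ _.
have gp : enum_rank g = p :> nat.
  have -> : g = enum_val (Ordinal hp) by rewrite (enum_val_nth f0).
  by rewrite enum_valK.
apply/eqP/existsP => [[gm]|[f /andP[fm /eqP fp]]].
  by exists g; rewrite gm gp eqxx.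
congr Some; rewrite -fm; congr (_ \in m).
by apply: enum_rank_inj; apply: val_inj; rewrite /= fp.
Qed.

Lemma read_phase s (m : {ffun 'I_D -> {set F}}) an p : p <= L ->
  iter p cstep (cconf s (quiet D F) 0 [ffun i => bits (m i)] (no_mail D) an)
  = cconf s [ffun i => [set f in m i | enum_rank f < p]] p
      [ffun i => drop p (bits (m i))] (no_mail D) an.
Proof.
elim: p => [_|p IH hp].
  rewrite /=; congr (cconf _ _ _ _ _ _); apply/ffunP=> i; rewrite !ffunE ?drop0 //.
  by apply/setP=> f; rewrite !inE ltn0 andbF.
rewrite iterS IH ?(ltnW hp) //.
have ip : (inord (p) : 'I_last_phase.+1) = p :> nat.
  by apply: inord_phase; lia.
apply: conf_eq; rewrite /= ?ip ?hp //=.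
- congr (_, _, _).
  apply/ffunP=> i; rewrite !ffunE drop_bits //; apply/setP=> f.
  have [fp|fp] := eqVneq (nat_of_ord (enum_rank f)) p; last first.
    have lt_p : (enum_rank f < p.+1) = (enum_rank f < p) by lia.
    by case: existsP => _; rewrite !inE lt_p ?(negbTE fp) ?orbF ?andbT.
  case: existsP => [[g /andP[gm /eqP gp]]|no]; rewrite !inE fp ltnn ltnSn ?eqxx andbF andbT /=.
    rewrite -gm; congr (_ \in m i).
    by apply: enum_rank_inj; apply: val_inj; rewrite /= fp.
  by apply/esym/negP=> fm; apply: no; exists f; rewrite fm fp eqxx.
- by apply/ffunP=> i; rewrite !ffunE inE -drop1 drop_drop add1n.
- by apply/ffunP=> i; rewrite !ffunE.
Qed.

Lemma compute_phase s m ob an :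
  cstep (cconf s m L (no_mail D) ob an)
  = cconf (pstep s m).1 (pstep s m).2 L.+1 (no_mail D) ob an.
Proof.
have ip : (inord (L) : 'I_last_phase.+1) = L :> nat.
  by apply: inord_phase; lia.
apply: conf_eq; rewrite /= ?ip ?ltnn ?eqxx //=.
- by case: (pstep s m).
- by apply/ffunP=> i; rewrite !ffunE inE.
- by apply/ffunP=> i; rewrite !ffunE.
Qed.

Lemma write_phase s m an q : q <= L ->
  iter q cstep (cconf s m L.+1 (no_mail D) (no_mail D) an)
  = cconf s m (L.+1 + q) (no_mail D) [ffun i => take q (bits (m i))] an.
Proof.
elim: q => [_|q IH hq].
  by rewrite /= addn0; congr (cconf _ _ _ _ _ _); apply/ffunP=> i; rewrite !ffunE take0.
rewrite iterS IH ?(ltnW hq) //.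
have ip : (inord (L.+1 + q) : 'I_last_phase.+1) = L.+1 + q :> nat.
  by apply: inord_phase; lia.
have e1 : (L.+1 + q < L) = false by lia.
have e2 : (L.+1 + q == L) = false by lia.
have e3 : L.+1 + q <= L.*2 by lia.
apply: conf_eq; rewrite /= ?ip ?e1 ?e2 ?e3 ?addnS //=.
- by apply/ffunP=> i; rewrite !ffunE inE.
apply/ffunP=> i; rewrite !ffunE.
have [m0|nz] := eqVneq (m i) set0; first by rewrite /bits m0 eqxx.
have hs : q < size (bits (m i)) by rewrite /bits (negbTE nz) size_map -cardE.
rewrite (take_nth false hs); congr rcons.
have := drop_bits (m i) hq; rewrite (ohead_drop false hs) => e.
rewrite -[RHS]eqb_id -[in RHS](inj_eq (@Some_inj _)) e.
by apply: eq_existsb => f; congr andb; rewrite eqn_add2l.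
Qed.

Definition answers (s : pstate A) : seq (l.-tuple C) :=
  if phalt s then [seq c <- enum {: l.-tuple C} | c \in pans s] else [::].

Lemma answer_phase s m ob q : q <= Z ->
  iter q cstep (cconf s m L.*2.+1 (no_mail D) ob [::])
  = cconf s m (L.*2.+1 + q) (no_mail D) ob
     (if phalt s then [seq c <- take q (enum {: l.-tuple C}) | c \in pans s] else [::]).
Proof.
elim: q => [_|q IH hq]; first by rewrite /= addn0 take0 /=; case: ifP.
rewrite iterS IH ?(ltnW hq) //.
have ip : (inord (L.*2.+1 + q) : 'I_last_phase.+1) = L.*2.+1 + q :> nat.
  by apply: inord_phase; lia.
have e1 : (L.*2.+1 + q < L) = false by lia.
have e2 : (L.*2.+1 + q == L) = false by lia.
have e3 : (L.*2.+1 + q <= L.*2) = false by lia.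
have e4 : (L.*2.+1 + q <= L.*2 + Z) by lia.
apply: conf_eq; rewrite /= ?ip ?e1 ?e2 ?e3 ?e4 ?addnS //=.
- by apply/ffunP=> i; rewrite !ffunE inE.
- by apply/ffunP=> i; rewrite !ffunE.
case: (phalt s) => //.
set c0 := enum_val (Ordinal hq).
have c0q : enum_rank c0 = q :> nat by rewrite enum_valK.
have -> : take q.+1 (enum {: l.-tuple C}) = rcons (take q (enum {: l.-tuple C})) c0.
  by rewrite (take_nth c0) -?cardE // {2}/c0 (enum_val_nth c0).
(* The phase number fixes the rank, so [c0] is the only tuple that can be picked. *)
rewrite filter_rcons; case: pickP => [c /andP[cs /eqP hc]|no].
  have -> : c0 = c by apply: enum_rank_inj; apply: val_inj; rewrite /= c0q; move/addnI: hc.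
  by rewrite cs.
by have := no c0; rewrite c0q eqxx andbT => ->.
Qed.

(** One step for each phase from 0 to [last_phase], a number that does not depend on the network. *)
Definition round_steps := last_phase.+1.

Lemma final_phase s m ob an :
  cstep (cconf s m last_phase (no_mail D) ob an)
  = cconf s (quiet D F) 0 (no_mail D) ob an.
Proof.
have ip : (inord (last_phase) : 'I_last_phase.+1) = last_phase :> nat.
  by apply: inord_phase; lia.
have e1 : (last_phase < L) = false by lia.
have e2 : (last_phase == L) = false by lia.
have e3 : (last_phase <= L.*2) = false by lia.
have e4 : (last_phase <= L.*2 + Z) = false by lia.
apply: conf_eq; rewrite /= ?ip ?e1 ?e2 ?e3 ?e4 //=.
- by congr (_, _, _); apply/val_inj; rewrite /= inord_phase.
- by apply/ffunP=> i; rewrite !ffunE inE.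
- by apply/ffunP=> i; rewrite !ffunE.
Qed.

Lemma stopped_cconf s m p ib ob an : 0 < p <= last_phase ->
  ~~ stopped (cconf s m p ib ob an).
Proof.
move=> /andP[p0 pl]; rewrite /stopped /halted /=.
have -> : ((inord p : 'I_last_phase.+1) == ord0) = false; last by [].
by apply/eqP=> /(congr1 val); rewrite /= inord_phase //; lia.
Qed.

Definition mail_bits (m : {ffun 'I_D -> {set F}}) : {ffun 'I_D -> seq bool} :=
  [ffun i => bits (m i)].

(** The phases are chained one after the other, and every intermediate configuration has a positive
    phase, hence is not stopped. The answer starts empty because a node that has not halted has
    written nothing. *)
Lemma round_computes s m : ~~ phalt s ->
  computes_in (cconf s (quiet D F) 0 (mail_bits m) (no_mail D) [::])
    (cconf (pstep s m).1 (quiet D F) 0 (no_mail D) (mail_bits (pstep s m).2)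
       (answers (pstep s m).1)) round_steps.
Proof.
move=> hs; set x := cconf _ _ _ _ _ _; set s' := (pstep s m).1; set m' := (pstep s m).2.
have r1 p : p <= L -> iter p cstep x = _ := @read_phase s m [::] p.
have r2 : iter L.+1 cstep x = cconf s' m' L.+1 (no_mail D) (no_mail D) [::].
  rewrite iterS r1 //.
  have -> : [ffun i => drop L (bits (m i))] = no_mail D.
    by apply/ffunP=> i; rewrite !ffunE drop_oversize // size_bits.
  rewrite compute_phase.
  have -> // : [ffun i => [set f in m i | enum_rank f < L]] = m.
  by apply/ffunP=> i; rewrite !ffunE; apply/setP=> f; rewrite inE ltn_ord andbT.
have r3 q : q <= L -> iter (L.+1 + q) cstep x
    = cconf s' m' (L.+1 + q) (no_mail D) [ffun i => take q (bits (m' i))] [::].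
  by move=> hq; rewrite {1}addnC iterD r2 write_phase.
have r4 : iter L.*2.+1 cstep x
    = cconf s' m' L.*2.+1 (no_mail D) (mail_bits m') [::].
  have -> : L.*2.+1 = L.+1 + L by lia.
  rewrite r3 //; congr (cconf _ _ _ _ _ _).
  by apply/ffunP=> i; rewrite !ffunE take_oversize // size_bits.
have r5 q : q <= Z -> iter (L.*2.+1 + q) cstep x
    = cconf s' m' (L.*2.+1 + q) (no_mail D) (mail_bits m')
     (if phalt s' then [seq c <- take q (enum {: l.-tuple C}) | c \in pans s'] else [::]).
  by move=> hq; rewrite {1}addnC iterD r4 answer_phase.
have r6 : iter round_steps cstep x
    = cconf s' (quiet D F) 0 (no_mail D) (mail_bits m') (answers s').
  rewrite iterS -[last_phase]addSn r5 // final_phase /answers.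
  by rewrite take_oversize // -cardE.
split=> //.
  by apply/orP; left; apply/eqP/val_inj; rewrite /= inord_phase.
move=> j /andP[j0 jr].
have [jL|Lj] := leqP j L.
  by rewrite r1 //; apply: stopped_cconf; lia.
have [jL2|L2j] := leqP j L.*2.+1.
  have -> : j = L.+1 + (j - L.+1) by lia.
  by rewrite r3; [apply: stopped_cconf|]; lia.
have -> : j = L.*2.+1 + (j - L.*2.+1) by lia.
by rewrite r5; [apply: stopped_cconf|]; rewrite /round_steps in jr *; lia.
Qed.

End Compile.

(** * Machine executions that simulate protocol runs *)

Section CompileCorrect.

Variables (C : finType) (k D l : nat) (A : protocol C D l).

(* A passive node behaves as one that runs silently in its initial state. *)
Hypothesis init_quiet : forall c nb,
  pstep (pinit A c nb false) (quiet D _) = (pinit A c nb false, quiet D _).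
Hypothesis init_running : forall c nb b, ~~ phalt (pinit A c nb b).

Variables (N : network C k D) (P : port_numbering N) (r : N).

Notation x := (fun t a =>
  let: (s, m) := prun P A r t a in
  cconf s (quiet D (pitem A)) 0 (no_mail D) (mail_bits m) (answers s)).

Lemma mail_compiled t a :
  mail P (x t) a = mail_bits (pmail P (prun P A r t) a).
Proof.
apply/ffunP=> i; rewrite !ffunE.
have b0 : bits (set0 : {set pitem A}) = [::] by rewrite /bits eqxx.
case: (port P a i) => [b|//]; case: pickP => [j _|//].
by case: prun => s m /=; rewrite ffunE.
Qed.

Lemma mail_bits_quiet (m : {ffun 'I_D -> {set pitem A}}) :
  mail_bits m = no_mail D -> m = quiet D _.
Proof.
move=> /ffunP e; apply/ffunP=> i; have := e i; rewrite !ffunE => /eqP.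
by apply: contraTeq; rewrite bits_nil.
Qed.

Lemma mail_bits_no_mail : mail_bits (quiet D (pitem A)) = no_mail D.
Proof. by apply/ffunP=> i; rewrite !ffunE /bits eqxx. Qed.

(** The protocol runs at all nodes from the start, while a machine idles until its first mail. The
    two agree because without mail [init_quiet] keeps a node in its initial state. *)
Lemma asleep_prun t s a : ~~ awake P r x t a -> s <= t.+1 ->
  prun P A r s a = (pstart P A r a, quiet D _).
Proof.
rewrite negb_or negb_exists => /andP[ar /forallP noms].
have pm u : u <= t -> pmail P (prun P A r u) a = quiet D _.
  move=> hu; apply: mail_bits_quiet.
  by have := noms (Ordinal (hu : u < t.+1)); rewrite negbK mail_compiled => /eqP.
elim: s => [//|s IH] hs.
rewrite [prun _ _ _ _.+1]/= /pround IH ?(ltnW hs) //= pm //.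
by rewrite /pstart (negbTE ar) (negbTE (init_running _ _ _)) init_quiet.
Qed.

(** Transfers step counts, halting, answers and messages from [prun] to the machine, so that only
    [prun] remains to be studied. *)
Lemma compile_execution :
  exists (x : nat -> N -> conf (compiled A)) (steps : nat -> N -> nat),
  [/\ execution P r x steps,
      forall t a, halted (x t a) = phalt (prun P A r t a).1,
      forall t a, phalt (prun P A r t a).1 ->
        answer (x t a) =i pans (prun P A r t a).1,
      forall t a, steps t a <= round_steps A &
      forall t a i, size (outbox (x t a) i) <= #|pitem A| /\
        (outbox (x t a) i != [::]) = ((prun P A r t a).2 i != set0)].
Proof.
have hx t a : halted (x t a) = phalt (prun P A r t a).1.
  case: prun => s m /=; rewrite /halted /= (_ : inord 0 == _) //.
  by apply/eqP/val_inj; rewrite /= inord_phase.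
exists x, (fun t a => if awake P r x t a && ~~ halted (x t a)
                      then round_steps A else 0).
split=> //.
- split=> [a|t a].
    apply: conf_eq => //=; last by rewrite /answers (negbTE (init_running _ _ _)).
      by congr (_, _, _); apply/val_inj; rewrite /= inord_phase.
    by rewrite mail_bits_no_mail.
  case: (boolP (awake P r x t a && ~~ halted (x t a))) => [/andP[aw nh]|].
    rewrite mail_compiled [prun _ _ _ _.+1]/= /pround; rewrite hx in nh.
    rewrite (negbTE nh); case: prun nh => s m /= nh.
    case e: (pstep _ _) => [s' m'].
    have := round_computes (pmail P (prun P A r t) a) nh; rewrite e /=.
    by rewrite /load /= /answers (negbTE nh).
  rewrite negb_and negbK => /orP[sl|ha]; split=> //.
    by rewrite !(asleep_prun sl) // /load /= mail_bits_no_mail.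
  rewrite [prun _ _ _ _.+1]/= /pround; rewrite hx in ha; rewrite ha.
  by case: prun => s m; rewrite /load /= mail_bits_no_mail.
- move=> t a ph; have := hx t a; case: prun ph => s m /= ph _ c.
  by rewrite /answers ph mem_filter mem_enum andbT.
- by move=> t a; case: ifP.
- move=> t a i; case: prun => s m /=; rewrite ffunE bits_nil.
  by split=> //; apply: size_bits.
Qed.

End CompileCorrect.

(** * Walks and traversals *)

Section Walks.

Variables (V : finType) (G : rel V).
Hypothesis Gsym : symmetric G.

(** The length is exact and the walk grows at its far end, as the route of a flooded packet does. *)
Fixpoint walk (j : nat) (a b : V) : bool :=
  if j is j'.+1 then [exists u, walk j' a u && G u b] else a == b.

Lemma walkP j a b :
  reflect (exists p, [/\ size p = j, path G a p & last a p = b]) (walk j a b).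
Proof.
elim: j b => [|j IH] b /=.
  apply: (iffP eqP) => [->|[p [/size0nil -> //]]].
  by exists [::].
apply: (iffP existsP) => [[u /andP[/IH[p [sp pp lp]] ub]]|[p [sp pp lp]]].
  by exists (rcons p b); rewrite size_rcons sp rcons_path pp lp last_rcons.
case/lastP: p sp pp lp => // p c; rewrite size_rcons rcons_path last_rcons.
move=> [sp] /andP[pp pc] <-; exists (last a p); rewrite pc andbT.
by apply/IH; exists p.
Qed.

Lemma walk_sym j a b : walk j a b = walk j b a.
Proof.
suff sub c d : walk j c d -> walk j d c by apply/idP/idP; apply: sub.
case/walkP=> p [sp pp lp]; apply/walkP; exists (rev (belast c p)); split.
- by rewrite size_rev size_belast.
- rewrite -lp rev_path; rewrite (eq_path (e' := G)) // => x y; exact: Gsym.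
- by case: p {sp pp} lp => [|e p _] /=; [move=> ->|rewrite rev_cons last_rcons].
Qed.

Lemma walkD i j a b c : walk i a b -> walk j b c -> walk (i + j) a c.
Proof.
move=> wi; elim: j c => [|j IH] c; first by move/eqP <-; rewrite addn0.
case/existsP=> u /andP[wu uc]; rewrite addnS /=; apply/existsP; exists u.
by rewrite IH.
Qed.

Lemma walk1 a b : walk 1 a b = G a b.
Proof.
apply/existsP/idP => [[u /andP[/eqP -> //]]|ab].
by exists a; rewrite /= eqxx.
Qed.

Lemma ballP m a b :
  reflect (exists2 j, j <= m & walk j a b) (b \in ball G m a).
Proof.
rewrite inE; apply: (iffP existsP) => [[i /existsP[p /andP[pp /eqP lp]]]|].
  by exists i; [rewrite -ltnS|apply/walkP; exists p; rewrite size_tuple].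
case=> j jm /walkP[p [sp pp lp]].
exists (Ordinal (jm : j < m.+1)); apply/existsP.
have sp' : size p == Ordinal (jm : j < m.+1) by rewrite /= sp.
by exists (Tuple sp'); rewrite /= pp lp eqxx.
Qed.

Lemma ball_sym m a b : (a \in ball G m b) = (b \in ball G m a).
Proof.
by apply/ballP/ballP => -[j jm w]; exists j; rewrite // walk_sym.
Qed.

Lemma ball_self m a : a \in ball G m a.
Proof. by apply/ballP; exists 0; rewrite //= eqxx. Qed.

Lemma ballS m a b :
  (b \in ball G m.+1 a)
  = (b \in ball G m a) || [exists u in ball G m a, G u b].
Proof.
apply/ballP/orP => [[[|j] jm w]|[/ballP[j jm w]|]].
- by left; apply/ballP; exists 0.
- case/existsP: w => u /andP[w ub]; right; apply/existsP; exists u.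
  by rewrite ub andbT; apply/ballP; exists j.
- by exists j; rewrite // ltnW.
case/existsP=> u /andP[/ballP[j jm w] ub]; exists j.+1 => //=.
by apply/existsP; exists u; rewrite w.
Qed.

Hypothesis Gconn : forall a b, connect G a b.

(** A path without repeated nodes has fewer than [#|V|] edges. *)
Lemma ball_total a b : b \in ball G #|V|.-1 a.
Proof.
have /connectP[p pp ->] := Gconn a b; case/shortenP: pp => q qp uq _.
apply/ballP; exists (size q); last by apply/walkP; exists q.
have := max_card (mem (a :: q)); rewrite (card_uniqP uq) /=.
by move=> h; rewrite -ltnS (leq_trans h) // leqSpred.
Qed.

Lemma dist_exists a b : exists m, b \in ball G m a.
Proof. by exists #|V|.-1; apply: ball_total. Qed.

Definition dist a b : nat := ex_minn (dist_exists a b).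

Lemma dist_leq a b m : (dist a b <= m) = (b \in ball G m a).
Proof.
rewrite /dist; case: ex_minnP => d hd mind.
apply/idP/idP => [dm|]; last exact: mind.
by case/ballP: hd => j jd w; apply/ballP; exists j; rewrite // (leq_trans jd).
Qed.

Lemma dist_lt_card a b : dist a b < #|V|.
Proof.
have := ball_total a b; rewrite -dist_leq.
have : 0 < #|V| by apply/card_gt0P; exists a.
lia.
Qed.

Lemma dist_eq0 a b : (dist a b == 0) = (a == b).
Proof.
rewrite -leqn0 dist_leq; apply/ballP/idP => [[j]|/eqP->]; last first.
  by exists 0 => /=.
by rewrite leqn0 => /eqP ->.
Qed.

Lemma dist_walk r j a b : walk j a b -> dist r b <= dist r a + j.
Proof.
move=> w; have : a \in ball G (dist r a) r by rewrite -dist_leq.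
case/ballP=> i ia wi; rewrite dist_leq; apply/ballP; exists (i + j).
  by rewrite leq_add2r.
exact: walkD w.
Qed.

Lemma dist_pred r b m : dist r b = m.+1 -> exists2 u, G u b & dist r u = m.
Proof.
move=> e; have : b \in ball G m.+1 r by rewrite -dist_leq e.
rewrite ballS -dist_leq e ltnn /= => /existsP[u /andP[]].
rewrite -dist_leq => um ub; exists u => //.
by have := @dist_walk r 1 u b; rewrite walk1 ub e => /(_ isT); lia.
Qed.

End Walks.

(** * Tarry's traversal *)

Section Tarry.

Definition tarry_port (D : nat) (ports used : {set 'I_D}) (par : option 'I_D) :
    option 'I_D :=
  if [pick i in ports :\: used | Some i != par] is Some i then Some i
  else if par is Some i then if i \in used then None else Some i else None.

Lemma tarry_port_some D (ports used : {set 'I_D}) par i :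
  tarry_port ports used par = Some i ->
  [/\ (i \in ports) || (par == Some i), i \notin used
    & par = Some i -> ports \subset i |: used].
Proof.
rewrite /tarry_port; case: pickP => [i' /andP[]|no].
  rewrite !inE => /andP[iu ip] ipar [<-]; split=> //; first by rewrite ip.
  by move=> e; rewrite e eqxx in ipar.
case: par no => // j no; case: ifPn => // ju [<-]; rewrite eqxx orbT.
split=> // _; apply/subsetP=> x xp; have := no x.
rewrite !inE xp andbT => /negbT; rewrite negb_and !negbK => /orP[->|].
  by rewrite orbT.
by move/eqP=> [->]; rewrite eqxx.
Qed.

Lemma tarry_port_none D (ports used : {set 'I_D}) par :
  tarry_port ports used par = None -> ports \subset used.
Proof.
rewrite /tarry_port; case: pickP => // no e; apply/subsetP=> x xp.
have := no x; rewrite !inE xp andbT => /negbT.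
rewrite negb_and !negbK => /orP[//|/eqP px].
by move: e; rewrite -px; case: ifP.
Qed.

Variables (C : finType) (k D : nat) (N : network C k D).
Variables (P : port_numbering N) (r : N).

Record tconf := TConf {
  tholder : N;
  tused : N -> {set 'I_D};
  tpar : N -> option 'I_D }.

Definition links (v : N) : {set 'I_D} := [set i | port P v i].

Definition back (w v : N) : option 'I_D := [pick j | port P w j == Some v].

Lemma port_linked v i w : port P v i = Some w -> adj v w.
Proof. by move=> e; rewrite (port_adj P); apply/existsP; exists i; rewrite e. Qed.

Lemma backP v w i : port P v i = Some w ->
  exists2 j, back w v = Some j & port P w j = Some v.
Proof.
move/port_linked; rewrite adj_sym (port_adj P) => /existsP[j jw].
rewrite /back; case: pickP => [j' /eqP ej|/(_ j)]; last by rewrite jw.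
by exists j'.
Qed.

Lemma back_port w v j : port P w j = Some v -> back w v = Some j.
Proof.
move=> e; rewrite /back; case: pickP => [j' /eqP e'|/(_ j)].
  by rewrite (port_inj e e').
by rewrite e eqxx.
Qed.

Definition tnext (c : tconf) : option tconf :=
  let h := tholder c in
  if tarry_port (links h) (tused c h) (tpar c h) is Some i then
    if port P h i is Some w then
      Some (TConf w
        (fun v => if v == h then i |: tused c v else tused c v)
        (fun v => if [&& v == w, v != r & tpar c v == None]
                  then back w h else tpar c v))
    else None
  else None.

Definition tinit : tconf := TConf r (fun=> set0) (fun=> None).

(** The ports through which the token has entered v, read off from the ports used at the other ends
    of its links. *)
Definition received (c : tconf) (v : N) : {set 'I_D} :=
  [set j | if port P v j is Some u
           then [exists i in tused c u, port P u i == Some v] else false].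

Definition tvisited (c : tconf) (v : N) : bool := (v == r) || tpar c v.

(** [tinv_balance] compares arrivals and departures at a node: they differ only through the start at
    r and the present holder. [tinv_last] says that the parent's link is used last, and [tinv_rank]
    that parent links form no cycle. *)
Record tinv (c : tconf) : Prop := TInv {
  tinv_used : forall v, tused c v \subset links v;
  tinv_balance : forall v,
    #|received c v| + (v == r) = #|tused c v| + (v == tholder c);
  tinv_root : tpar c r = None;
  tinv_unvisited : forall v, ~~ tvisited c v ->
    tused c v = set0 /\ v != tholder c;
  tinv_par : forall v j, tpar c v = Some j ->
    exists2 u, port P v j = Some u & tvisited c u;
  tinv_last : forall v j, tpar c v = Some j -> j \in tused c v ->
    links v \subset tused c v;
  tinv_rank : exists f : N -> nat, forall v j u,
    tpar c v = Some j -> port P v j = Some u -> f u < f v }.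

Lemma tinv_init : tinv tinit.
Proof.
split=> //.
- by move=> v; rewrite sub0set.
- move=> v /=; rewrite cards0; congr (_ + _); apply/eqP; rewrite cards_eq0.
  apply/eqP/setP=> j; rewrite !inE; case: port => // u.
  by apply/existsP=> -[i]; rewrite inE.
- by move=> v; rewrite /tvisited orbF.
- by exists (fun=> 0).
Qed.

Lemma received_sub c v : received c v \subset links v.
Proof. by apply/subsetP=> j; rewrite !inE; case: port. Qed.

Lemma tnextP c c' : tinv c -> tnext c = Some c' ->
  exists i w, [/\ tarry_port (links (tholder c)) (tused c (tholder c))
                    (tpar c (tholder c)) = Some i,
    port P (tholder c) i = Some w & c' = TConf w
        (fun v => if v == tholder c then i |: tused c v else tused c v)
        (fun v => if [&& v == w, v != r & tpar c v == None]
                  then back w (tholder c) else tpar c v)].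
Proof.
move=> ic; rewrite /tnext; case e: tarry_port => [i|//].
by case e': port => [w|//] [<-]; exists i, w.
Qed.

Lemma tnext_none c : tinv c -> tnext c = None ->
  tarry_port (links (tholder c)) (tused c (tholder c)) (tpar c (tholder c))
  = None.
Proof.
move=> ic; rewrite /tnext; case e: tarry_port => [i|//].
case e': port => [//|] _; case/tarry_port_some: e => /orP[il|/eqP pi] _ _.
  by rewrite inE e' in il.
by case: (tinv_par ic pi) => u; rewrite e'.
Qed.

Lemma tinv_next c c' : tinv c -> tnext c = Some c' -> tinv c'.
Proof.
move=> ic /(tnextP ic)[i [w [ti hw ->]]] {c'}; set h := tholder c in ti hw *.
have [_ iu ilast] := tarry_port_some ti.
have [j bj pj] := backP hw.
have wh : w != h by apply: contraTneq (port_linked hw) => ->; rewrite adj_irr.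
have il : i \in links h by rewrite inE hw.
have vh : tvisited c h.
  by apply: contraT => nv; have [_] := tinv_unvisited ic nv; rewrite eqxx.
set c' := TConf _ _ _.
have vis v : tvisited c v -> tvisited c' v.
  rewrite /tvisited => /orP[->//|pv] /=; case: ifP => [/and3P[_ _ /eqP e]|_].
    by rewrite e in pv.
  by rewrite pv orbT.
have rcv v : v != w -> received c' v = received c v.
  move=> vw; apply/setP=> j'; rewrite !inE; case: port => // u.
  apply: eq_existsb => i' /=; case: eqP => // ->; rewrite !inE.
  case: (eqVneq i' i) => //= ->; rewrite hw (negbTE iu) /=.
  by apply/eqP=> -[e]; rewrite e eqxx in vw.
have rcw : received c' w = j |: received c w.
  apply/setP=> j'; rewrite !inE; have [->|jj] := eqVneq j' j.
    rewrite pj; apply/existsP; exists i; rewrite /= -/h eqxx !inE eqxx /=.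
    by rewrite hw.
  case ej: port => [u|//] /=; apply: eq_existsb => i' /=.
  case: eqP => // eu; move: jj; rewrite eu in ej.
  by rewrite (port_inj ej pj) eqxx.
have jw : j \notin received c w.
  rewrite inE pj; apply/existsP=> -[i' /andP[i'u /eqP e]].
  by rewrite (port_inj hw e) i'u in iu.
split.
- move=> v /=; case: eqP => [->|_]; last exact: tinv_used.
  by rewrite subUset sub1set il tinv_used.
- move=> v; have := tinv_balance ic v; rewrite -/h /=.
  have [->|vw] := eqVneq v w.
    by rewrite rcw cardsU1 jw (negbTE wh) addn0 addn1 add1n addSn => ->.
  rewrite rcv //; have [->|_] := eqVneq v h; last by [].
  by rewrite cardsU1 iu => ->; rewrite addn0 addn1 add1n.
- by rewrite /= eqxx andbF tinv_root.
- move=> v nv; have nv' : ~~ tvisited c v by apply: contra nv; apply: vis.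
  have [u0 vh'] := tinv_unvisited ic nv'; rewrite /= -/h (negbTE vh').
  split=> //; apply: contra nv => /eqP ->.
  rewrite /tvisited /= eqxx /=; case: eqP => //= _.
  by case: (tpar c w) => [j'|] //=; rewrite bj.
- move=> v j' /=; case: ifP => [/and3P[/eqP -> _ _]|_].
    rewrite bj => -[<-]; exists h => //; exact: vis.
  by case/(tinv_par ic) => u e /vis; exists u.
- move=> v j' /=; case: ifP => [/and3P[/eqP -> wr /eqP pw]|_ pv].
    have : ~~ tvisited c w by rewrite /tvisited negb_or wr pw.
    by case/(tinv_unvisited ic) => -> _; rewrite (negbTE wh) inE.
  have [vh'|_] := eqVneq v h; last exact: tinv_last pv.
  rewrite vh' -/h in pv *; rewrite !inE => /orP[/eqP e|ju].
    by apply: ilast; rewrite pv e.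
  by apply: subset_trans (tinv_last ic pv ju) _; apply: subsetUr.
have [f hf] := tinv_rank ic.
(* A newly visited node is ranked one above its parent. Old inequalities survive because parents are
   visited, so no node has the new one as its parent yet. *)
exists (fun v => if [&& v == w, v != r & tpar c v == None] then (f h).+1
                 else f v) => v j' u /=.
case: ifP => [/and3P[/eqP -> wr pw]|_].
  rewrite bj => -[<-]; rewrite pj => -[<-].
  by rewrite eq_sym (negbTE wh) ltnSn.
move=> pv eu; case: ifP => [/and3P[/eqP uw ur pu]|_]; last exact: hf eu.
have [u' eu' ] := tinv_par ic pv; rewrite eu in eu'; case: eu' => <-.
by rewrite /tvisited (negbTE ur) /=; move/eqP: pu => ->.
Qed.

(** Away from r, a stuck holder would have used all its links and been entered once more than that,
    which is too often. At r, completeness of the visited nodes together with connectivity shows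
    that the traversal has reached everything. *)
Lemma stuck_all_visited c : tinv c -> tnext c = None ->
  tholder c = r /\ forall v, tvisited c v.
Proof.
move=> ic /(tnext_none ic)/tarry_port_none full.
have bal := tinv_balance ic.
have card_full v : links v \subset tused c v -> #|tused c v| = #|links v|.
  move=> s; congr #|pred_of_set _|; apply/eqP.
  by rewrite eqEsubset s tinv_used.
have hr : tholder c = r.
  apply/eqP; apply: contraT => hr; have := bal (tholder c).
  rewrite (negbTE hr) eqxx (card_full _ full).
  by have := subset_leq_card (received_sub c (tholder c)); lia.
split=> //; rewrite hr in full bal.
have complete v : #|received c v| = #|links v| -> received c v = links v.
  by move=> e; apply/eqP; rewrite eqEcard received_sub e leqnn.
(* Induction along parent links: a parent that was entered through all its links was entered from v,
   so v has used its parent's link, hence all its links, and by balance was entered through all of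
   them. *)
have compl : forall v, tvisited c v -> received c v = links v.
  have [f hf] := tinv_rank ic.
  move=> v; elim: {v}_.+1 {-2}v (ltnSn (f v)) => // n IH v fv vv.
  have [->|vr] := eqVneq v r.
    by apply: complete; have := bal r; rewrite eqxx (card_full _ full); lia.
  move: vv; rewrite /tvisited (negbTE vr) /=; case pv: (tpar c v) => [j|//] _.
  have [u pu uv] := tinv_par ic pv.
  have /IH/(_ uv) ru : f u < n by have := hf _ _ _ pv pu; lia.
  have [i bi pi] := backP pu.
  have : i \in received c u by rewrite ru inE pi.
  rewrite inE pi => /existsP[j' /andP[j'u /eqP ej]].
  rewrite -(port_inj pu ej) in j'u.
  have fv' := tinv_last ic pv j'u.
  by apply: complete; have := bal v; rewrite (negbTE vr) (card_full _ fv'); lia.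
have closed u v : tvisited c u -> adj u v -> tvisited c v.
  move=> uv; rewrite (port_adj P) => /existsP[i /eqP pi].
  have : i \in received c u by rewrite compl // inE pi.
  rewrite inE pi => /existsP[j /andP[ju _]]; apply: contraT => nv.
  by have [e _] := tinv_unvisited ic nv; rewrite e inE in ju.
move=> v; have /connectP[p pp ->] := adj_connected r v.
have : tvisited c r by rewrite /tvisited eqxx.
elim: p (r : node N) pp => //= u p IH a /andP[au pu] va.
by apply: (IH u) => //; apply: closed au.
Qed.

Fixpoint traj (i : nat) : tconf :=
  if i is i'.+1 then odflt (traj i') (tnext (traj i')) else tinit.

Lemma tinv_traj i : tinv (traj i).
Proof.
elim: i => [|i IH] /=; first exact: tinv_init.
by case e: tnext => [c|//] /=; apply: tinv_next e.
Qed.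

(** Each move uses a fresh port, which bounds m from above. All nodes occur among the m + 1 holders,
    which bounds m from below; the lower bound later makes the second traversal last long enough. *)
Lemma tarry_total : exists m,
  [/\ (m <= #|N| * D) && (#|N| <= m.+1),
      forall i, i < m -> tnext (traj i) = Some (traj i.+1),
      tnext (traj m) = None, tholder (traj m) = r &
      forall v, exists2 i, i <= m & tholder (traj i) = v].
Proof.
pose live i := forall i', i' < i -> tnext (traj i') = Some (traj i'.+1).
have sum_used i : live i -> \sum_v #|tused (traj i) v| = i.
  elim: i => [_|i IH hl]; first by rewrite big1 // => v _; rewrite cards0.
  have e := hl i (ltnSn i); have ic := tinv_traj i.
  have [j [w [ti hw ->]]] := tnextP ic e.
  have [_ ju _] := tarry_port_some ti.
  rewrite (bigD1 (tholder (traj i))) //= eqxx cardsU1 ju.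
  rewrite -[in RHS](IH _); last by move=> i' hi; apply: hl; apply: ltnW.
  rewrite [in RHS](bigD1 (tholder (traj i))) //= -addnA add1n; congr (_ + _).+1.
  by apply: eq_bigr => v /negbTE ->.
have stops : exists m, ~~ tnext (traj m).
  exists (#|N| * D); apply/negP => st.
  pose m := (#|N| * D).+1.
  suff hl : live m.
    have := sum_used m hl; suff : \sum_v #|tused (traj m) v| <= #|N| * D by lia.
    rewrite -sum_nat_const; apply: leq_sum => v _.
    by rewrite -[D in _ <= D]card_ord max_card.
  have back_live i : tnext (traj i.+1) -> tnext (traj i).
    by rewrite /=; case e: (tnext (traj i)) => [c|] //=; rewrite e.
  have lt i : i < m -> tnext (traj i).
    suff gen d i' : i' + d = #|N| * D -> tnext (traj i').
      by move=> hi; apply: (gen (#|N| * D - i)); rewrite subnKC.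
    elim: d i' => [|d IH] i'; first by rewrite addn0 => ->.
    by rewrite addnS -addSn => /IH/back_live.
  by move=> i hi /=; have := lt i hi; case: tnext.
case: (ex_minnP stops) => m ms mmin.
have hl : live m.
  move=> i hi /=; case e: tnext => [c|] //=.
  by have := mmin i; rewrite e => /(_ isT); lia.
have mn : tnext (traj m) = None by case: tnext ms.
have [hr allv] := stuck_all_visited (tinv_traj m) mn.
(* Apart from r, a node becomes visited only by the move that brings the token to it. *)
have held i v : live i -> tvisited (traj i) v ->
    exists2 i', i' <= i & tholder (traj i') = v.
  elim: i => [_|i IH hli].
    by rewrite /tvisited orbF => /eqP ->; exists 0.
  have e := hli i (ltnSn i); have ic := tinv_traj i.
  have [j [w [ti hw ec]]] := tnextP ic e.
  case: (boolP (tvisited (traj i) v)) => [vv|nv] vv'.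
    have [|i' le_i e'] := IH _ vv; last by exists i'; rewrite // ltnW.
    by move=> i' hi; apply: hli; apply: ltnW.
  exists i.+1 => //; move: vv'; rewrite ec /tvisited /=.
  move: nv; rewrite /tvisited negb_or => /andP[vr pv].
  by rewrite (negbTE vr) /=; case: eqP pv => [-> //|_] /=; case: tpar.
have hv v : exists2 i, i <= m & tholder (traj i) = v by apply: held.
have bound : m <= #|N| * D.
  rewrite -(sum_used m hl) -sum_nat_const; apply: leq_sum => v _.
  by rewrite -[D in _ <= D]card_ord max_card.
exists m; split=> //; rewrite bound.
rewrite -[m.+1]card_ord; pose g (i : 'I_m.+1) := tholder (traj i).
have -> : #|N| = #|codom g|; last exact: leq_image_card.
apply: eq_card => v; rewrite [LHS]inE; have [i im e] := hv v.
by apply/esym/codomP; exists (Ordinal (im : i < m.+1)).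
Qed.

End Tarry.

(** * Evaluation on labels *)

Lemma map_tuple_comp (A B E : Type) (n : nat) (f : B -> E) (g : A -> B)
  (t : n.-tuple A) : map_tuple f (map_tuple g t) = map_tuple (f \o g) t.
Proof. by apply: val_inj; rewrite /= -map_comp. Qed.

Lemma eq_map_tuple (A B : Type) (n : nat) (f g : A -> B) (t : n.-tuple A) :
  f =1 g -> map_tuple f t = map_tuple g t.
Proof. by move=> e; apply: val_inj; rewrite /= (eq_map e). Qed.

Section Transfer.

Variables (V W : finType) (L : V -> W) (G : rel V) (G' : rel W).
Variables (U : {set V}) (l : nat).
Variables (T : {set V * l.-tuple V}) (T' : {set W * l.-tuple W}).
Hypothesis L_inj : {in U &, injective L}.
Hypothesis G_eq : {in U &, forall a b, G' (L a) (L b) = G a b}.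
Hypothesis T_eq : forall a (c : l.-tuple V), a \in U -> all (mem U) c ->
  ((L a, map_tuple L c) \in T') = ((a, c) \in T).

(** Being injective on U, L is an isomorphism of U onto its image, and a formula whose quantifiers
    are relativized to U sees nothing else. *)
Lemma sat_transfer (X : Type) (f : formula l X) (e : X -> V) (e' : X -> W) :
  (forall x, e x \in U) -> (forall x, e' x = L (e x)) ->
  sat G' (L @: U) T' f e' = sat G U T f e.
Proof.
elim: f e e' => {X} [X x y|X x y|X x ys|X f IH|X f IHf g IHg|X f IHf g IHg
    |X f IH|X f IH] e e' eU ee /=.
- by rewrite !ee (inj_in_eq L_inj).
- by rewrite !ee G_eq.
- rewrite ee (eq_map_tuple _ ee) -(map_tuple_comp L e) T_eq //.
  by rewrite /= all_map; elim: (tval ys) => //= y s ->; rewrite eU.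
- by rewrite (IH e).
- by rewrite (IHf e) // (IHg e).
- by rewrite (IHf e) // (IHg e).
- have ext v : v \in U -> sat G' (L @: U) T' f (extend e' (L v))
      = sat G U T f (extend e v).
    by move=> vU; apply: IH => -[x|] //=.
  apply/existsP/existsP => [[w /andP[/imsetP[v vU ->]]]|[v /andP[vU s]]].
    by rewrite ext // => s; exists v; rewrite vU.
  by exists (L v); rewrite imset_f // ext.
- have ext v : v \in U -> sat G' (L @: U) T' f (extend e' (L v))
      = sat G U T f (extend e v).
    by move=> vU; apply: IH => -[x|] //=.
  apply/forallP/forallP => s v; apply/implyP => vU.
    by rewrite -ext //; have := s (L v); rewrite imset_f.
  by case/imsetP: vU => u uU ->; rewrite ext //; have := s u; rewrite uU.
Qed.

End Transfer.

(** * Stages, and their evaluation from the knowledge of one node *)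

Section Evaluation.

Variables (C : finType) (k D l : nat) (phi : formula l (option 'I_l)).
Variable N : network C k D.

Notation adjN := (@adj C k D N).
Notation ballN := (ball adjN k).
Notation labelN := (@label C k D N).
Notation stageN := (stage adjN k phi).

Lemma label_ball_inj (a : N) : {in ballN a &, injective labelN}.
Proof.
move=> b1 b2 h1 h2 e; apply/eqP; apply: contraT => /eqP ne.
by case: (label_consistent h1 h2 ne).
Qed.

Lemma card_ball (a : N) : #|ballN a| <= #|C|.
Proof.
by rewrite -(card_in_imset (@label_ball_inj a)) max_card.
Qed.

Lemma label_tuple_inj (a : N) (b c : l.-tuple N) :
  all (fun v => v \in ballN a) b -> all (fun v => v \in ballN a) c ->
  map_tuple labelN b = map_tuple labelN c -> b = c.
Proof.
move=> /allP hb /allP hc e; apply: eq_from_tnth => i.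
apply: (@label_ball_inj a); [exact/hb/mem_tnth|exact/hc/mem_tnth|].
by have := congr1 (fun t => tnth t i) e; rewrite !tnth_map.
Qed.

Lemma stage_subS i : stageN i \subset stageN i.+1.
Proof. exact: subsetUr. Qed.

Lemma stage_sub i j : i <= j -> stageN i \subset stageN j.
Proof.
elim: j => [|j IH]; first by rewrite leqn0 => /eqP ->.
rewrite leq_eqVlt => /orP[/eqP -> //|/IH s].
exact: subset_trans s (stage_subS j).
Qed.

Lemma stage_ball i a (b : l.-tuple N) :
  (a, b) \in stageN i -> all (fun v => v \in ballN a) b.
Proof.
elim: i => [|i IH]; first by rewrite inE.
by rewrite /= inE => /orP[|/IH //]; rewrite inE => /andP[].
Qed.

(** The entries of a tuple lie in the ball of its first component, where labels identify nodes; so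
    the first component and a tuple of labels determine it. This makes the number of stages linear
    in the number of nodes. *)
Lemma card_stage i : #|stageN i| <= #|N| * #|{: l.-tuple C}|.
Proof.
rewrite -cardX /=.
pose g (t : N * l.-tuple N) := (t.1, map_tuple labelN t.2).
rewrite -(@card_in_imset _ _ g) ?subset_leq_card //.
  by apply/subsetP=> t _; rewrite !inE.
move=> [a b] [a' b'] h h' [ea eb].
have ea' : a = a' by exact: ea.
rewrite -ea' in h' *; congr (_, _).
apply: (label_tuple_inj (stage_ball h) (stage_ball h')).
exact: val_inj.
Qed.

(** Once a stage repeats, all later ones are equal. Without a repetition in time, each stage would
    gain a tuple and exceed [card_stage]. *)
Lemma stage_stable i : #|N| * #|{: l.-tuple C}| <= i ->
  stageN i = stageN (#|N| * #|{: l.-tuple C}|).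
Proof.
set m := _ * _ => mi.
have fix_from j : stageN j.+1 = stageN j -> forall i, j <= i -> stageN i = stageN j.
  move=> e; elim=> [|i' IH]; first by rewrite leqn0 => /eqP ->.
  rewrite leq_eqVlt => /orP[/eqP -> //|/IH h].
  by rewrite [LHS]/= h.
suff [j jm e] : exists2 j, j <= m & stageN j.+1 = stageN j.
  by rewrite (fix_from j e i) ?(fix_from j e m) // (leq_trans jm).
have [/existsP[j /eqP e]|no] := boolP [exists j : 'I_m.+1, stageN j.+1 == stageN j].
  by exists j; rewrite // -ltnS.
have grow j : j <= m.+1 -> j <= #|stageN j|.
  elim: j => // j IH hj; apply: leq_ltn_trans (IH (ltnW hj)) _.
  apply: proper_card; rewrite properEneq stage_subS andbT eq_sym.
  by move: no; rewrite negb_exists => /forallP/(_ (Ordinal hj)).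
by have := leq_trans (grow _ (leqnn _)) (card_stage m.+1); rewrite ltnn.
Qed.

Lemma in_fixpointE t :
  in_fixpoint adjN k phi t <-> t \in stageN (#|N| * #|{: l.-tuple C}|).
Proof.
split=> [[i ti]|]; last by eexists; eassumption.
set m := _ * _; case: (leqP m i) => im; first by rewrite -(stage_stable im).
by apply: (subsetP (stage_sub (ltnW im))).
Qed.

(** This and the next two sets are what v ideally knows, expressed by labels, which serve as names
    inside its ball. The network itself, not the labels, decides which pairs are near or
    adjacent. *)
Definition near_spec (v : N) : {set C * C} :=
  [set p | [exists b in ballN v, exists c in ballN v,
              (c \in ballN b) && (p == (labelN b, labelN c))]].

Definition adj_spec (v : N) : {set C * C} :=
  [set p | [exists b in ballN v, exists c in ballN v,
              adjN b c && (p == (labelN b, labelN c))]].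

Definition store_spec (i : nat) (v : N) : {set C * l.-tuple C} :=
  [set p | [exists t in stageN i,
              (t.1 \in ballN v) && (p == (labelN t.1, map_tuple labelN t.2))]].

Definition ball_of (lab : C) (near : {set C * C}) : {set C} :=
  [set c | (c, lab) \in near].

(** A stored tuple of a node a may reach outside the ball of v, where a label can repeat one of the
    ball. Keeping only tuples whose entries are near their first component removes the ambiguity:
    inside the ball of a, a label determines the node. *)
Definition eval_at (lab : C) (near adjl : {set C * C})
    (store : {set C * l.-tuple C}) : {set l.-tuple C} :=
  [set g | all (fun c => c \in ball_of lab near) (g : l.-tuple C)
           && sat (fun c d => (c, d) \in adjl) (ball_of lab near)
                [set t in store | all (fun c => (t.1, c) \in near) t.2]
                phi (extend (tnth g) lab)].

Lemma mem_near_spec v b c : b \in ballN v -> c \in ballN v ->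
  ((labelN b, labelN c) \in near_spec v) = (c \in ballN b).
Proof.
move=> hb hc; rewrite inE; apply/existsP/idP => [|h].
  case=> b' /andP[hb' /existsP[c' /andP[hc' /andP[h /eqP[eb ec]]]]].
  by rewrite (label_ball_inj hb hb' eb) (label_ball_inj hc hc' ec).
by exists b; rewrite hb; apply/existsP; exists c; rewrite hc h eqxx.
Qed.

Lemma mem_adj_spec v b c : b \in ballN v -> c \in ballN v ->
  ((labelN b, labelN c) \in adj_spec v) = adjN b c.
Proof.
move=> hb hc; rewrite inE; apply/existsP/idP => [|h].
  case=> b' /andP[hb' /existsP[c' /andP[hc' /andP[h /eqP[eb ec]]]]].
  by rewrite (label_ball_inj hb hb' eb) (label_ball_inj hc hc' ec).
by exists b; rewrite hb; apply/existsP; exists c; rewrite hc h eqxx.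
Qed.

Lemma ball_of_spec v : ball_of (labelN v) (near_spec v) = labelN @: ballN v.
Proof.
have vv : v \in ballN v by apply: ball_self.
apply/setP=> c; rewrite inE; apply/idP/imsetP => [|[b hb ->]]; last first.
  by rewrite mem_near_spec // (ball_sym (@adj_sym _ _ _ N)).
rewrite inE => /existsP[b /andP[hb /existsP[c' /andP[_ /andP[_ /eqP[-> _]]]]]].
by exists b.
Qed.

Lemma mem_own_store i v (c : l.-tuple C) :
  ((labelN v, c) \in store_spec i v)
  <-> exists2 b : l.-tuple N, (v, b) \in stageN i & map_tuple labelN b = c.
Proof.
have vv : v \in ballN v by apply: ball_self.
rewrite inE; split=> [/existsP[[a b] /and3P[h /= av /eqP[el ec]]]|[b h <-]].
  exists b; last by [].
  by rewrite (label_ball_inj vv av el).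
by apply/existsP; exists (v, b); rewrite h vv eqxx.
Qed.

Lemma mem_eval i v (g : l.-tuple C) :
  g \in eval_at (labelN v) (near_spec v) (adj_spec v) (store_spec i v)
  <-> exists2 b : l.-tuple N,
        (v, b) \in local_op adjN k phi (stageN i) & map_tuple labelN b = g.
Proof.
have vv : v \in ballN v by apply: ball_self.
set T' := [set t in store_spec i v | all (fun c => (t.1, c) \in near_spec v) t.2].
have satE (b : l.-tuple N) : all (fun u => u \in ballN v) b ->
    sat (fun c d => (c, d) \in adj_spec v) (labelN @: ballN v) T' phi
      (extend (tnth (map_tuple labelN b)) (labelN v))
    = sat adjN (ballN v) (stageN i) phi (extend (tnth b) v).
  move=> /allP hb; apply: sat_transfer => //.
  - exact: label_ball_inj.
  - by move=> x y hx hy; rewrite mem_adj_spec.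
  - move=> a c ha /allP hc; rewrite inE /=; apply/andP/idP.
      case; rewrite inE => /existsP[[a' c'] /and3P[/= st a'v /eqP[ea ec]] near].
      move: st; rewrite -(label_ball_inj ha a'v ea) => st.
      suff -> : c = c' by [].
      apply: (@label_tuple_inj a) (stage_ball st) _; last exact: val_inj.
      (* Nearness puts the entries of c into the ball of a, which also contains those of c'; equal
         labels then mean equal nodes. *)
      apply/allP=> u uc; rewrite -(mem_near_spec ha (hc _ uc)).
      by apply: (allP near); apply: map_f.
    move=> st; split; first by rewrite inE; apply/existsP; exists (a, c); rewrite st ha eqxx.
    apply/allP=> u /mapP[w wc ->]; rewrite mem_near_spec //; last exact: hc.
    by apply: (allP (stage_ball st)).
  - by case=> [j|] //=; apply: hb; apply: mem_tnth.
  - by case=> [j|] //=; rewrite tnth_map.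
rewrite inE ball_of_spec; split=> [/andP[/allP hg s]|[b]]; last first.
  rewrite inE /= => /andP[hb s] <-; rewrite satE // s andbT.
  by apply/allP=> c /mapP[u ub ->]; apply: imset_f; apply: (allP hb).
have pre c : c \in labelN @: ballN v -> exists u, (u \in ballN v) && (labelN u == c).
  by case/imsetP=> u hu ->; exists u; rewrite hu eqxx.
pose b := [tuple if [pick u in ballN v | labelN u == tnth g j] is Some u then u else v | j < l].
have hb j : tnth b j \in ballN v /\ labelN (tnth b j) = tnth g j.
  rewrite tnth_mktuple; case: pickP => [u /andP[hu /eqP eu] //|no].
  by have [u] := pre _ (hg _ (mem_tnth j g)); rewrite no.
have eb : map_tuple labelN b = g.
  by apply: eq_from_tnth => j; rewrite tnth_map; case: (hb j).
have allb : all (fun u => u \in ballN v) b.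
  by apply/allP=> u /tnthP[j ->]; case: (hb j).
exists b => //; rewrite inE /= allb -satE // eb.
exact: s.
Qed.

Lemma new_tuples i v (g : l.-tuple C) :
  (g \in eval_at (labelN v) (near_spec v) (adj_spec v) (store_spec i v))
    && ((labelN v, g) \notin store_spec i v)
  <-> exists2 b : l.-tuple N,
        (v, b) \in stageN i.+1 :\: stageN i & map_tuple labelN b = g.
Proof.
split=> [/andP[/mem_eval[b hb eb] /negP ns]|[b]].
  exists b => //; rewrite inE; apply/andP; split; last by rewrite /= inE hb.
  by apply/negP=> st; apply: ns; apply/mem_own_store; exists b.
rewrite inE => /andP[nst]; rewrite /= inE (negbTE nst) orbF => hb eb.
apply/andP; split; first by apply/mem_eval; exists b.
apply/negP=> /mem_own_store[b' st' e']; move/negP: nst; apply.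
suff -> : b = b' by [].
apply: (@label_tuple_inj v) (stage_ball st') _; last by rewrite eb e'.
by move: hb; rewrite inE => /andP[].
Qed.

End Evaluation.

(** * The protocol *)

Section Items.

Variables (C : finType) (k l : nat).

(** [PBall] announces the label of a node that heard an activation. In [PNear] and [PAdj] the second
    component is the reporting node and the first the one it heard. [PFact] is a tuple of the
    fixpoint, named by labels. *)
Inductive payload :=
| PAct
| PBall of C
| PNear of C * C
| PAdj of C * C
| PFact of C * l.-tuple C.

Definition payload_enc (p : payload) :
    unit + C + (C * C) + (C * C) + (C * l.-tuple C) :=
  match p with
  | PAct => inl (inl (inl (inl tt)))
  | PBall c => inl (inl (inl (inr c)))
  | PNear x => inl (inl (inr x))
  | PAdj x => inl (inr x)
  | PFact x => inr x
  end.

Definition payload_dec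
    (x : unit + C + (C * C) + (C * C) + (C * l.-tuple C)) : payload :=
  match x with
  | inl (inl (inl (inl _))) => PAct
  | inl (inl (inl (inr c))) => PBall c
  | inl (inl (inr x)) => PNear x
  | inl (inr x) => PAdj x
  | inr x => PFact x
  end.

Lemma payload_encK : cancel payload_enc payload_dec.
Proof. by case. Qed.

HB.instance Definition _ := Finite.copy payload (can_type payload_encK).

(** The ordinal of a packet is the number of hops made at its arrival, so its range ends every flood
    at distance k. The boolean of a token is its traversal: false for the first, true for the
    second. *)
Inductive item :=
| IPkt of 'I_k.+1 * payload
| ITok of bool
| IStart
| IHalt.

Definition item_enc (f : item) : ('I_k.+1 * payload) + bool + bool :=
  match f with
  | IPkt x => inl (inl x)
  | ITok b => inl (inr b)
  | IStart => inr false
  | IHalt => inr true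
  end.

Definition item_dec (x : ('I_k.+1 * payload) + bool + bool) : item :=
  match x with
  | inl (inl x) => IPkt x
  | inl (inr b) => ITok b
  | inr false => IStart
  | inr true => IHalt
  end.

Lemma item_encK : cancel item_enc item_dec.
Proof. by case. Qed.

HB.instance Definition _ := Finite.copy item (can_type item_encK).

End Items.

Arguments PAct {C l}.
Arguments PBall {C l} _.
Arguments PNear {C l} _.
Arguments PAdj {C l} _.
Arguments IPkt {C k l} _.
Arguments ITok {C k l} _.
Arguments IStart {C k l}.
Arguments IHalt {C k l}.

(** * Node states and transition rule *)

Section Protocol.

Variables (C : finType) (k D l : nat) (phi : formula l (option 'I_l)).

Notation pay := (payload C l).
Notation itm := (item C k l).
Notation msgs := {ffun 'I_D -> {set itm}}.

(* [period]: rounds between two evaluations; [hmax].+1: rounds that the token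
   rests at a node, more than the 3k + 2 rounds of an activation, and long enough
   for n of them to cover all the stages. *)
Definition period := k.*2.+1.
Definition hmax := period * #|{: l.-tuple C}|.+1 + 3 * k + 3.

(* The booleans in [nhold], [nused] and [npar] tell the two traversals apart;
   [npend] holds the payloads to be flooded in the next round. *)
Record nstate := NState {
  nlab : C;
  nlinks : {set 'I_D};
  nroot : bool;
  nhold : option (bool * 'I_hmax.+1);
  nused : {ffun bool -> {set 'I_D}};
  npar : {ffun bool -> option 'I_D};
  npend : {set pay};
  nnear : {set C * C};
  nadj : {set C * C};
  nclock : option 'I_period;
  nstore : {set C * l.-tuple C};
  nhalt : bool }.

Definition nstate_enc (s : nstate) :=
  (nlab s, nlinks s, nroot s, nhold s, nused s, npar s, npend s, nnear s,
   nadj s, nclock s, nstore s, nhalt s).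

Definition nstate_dec x : nstate :=
  let: (a, b, c, d, e, f, g, h, i, j, m, n) := x in
  NState a b c d e f g h i j m n.

Lemma nstate_encK : cancel nstate_enc nstate_dec.
Proof. by case. Qed.

HB.instance Definition _ := Finite.copy nstate (can_type nstate_encK).

Definition got (m : msgs) (f : itm) : bool := [exists i, f \in m i].

(** A node hears its own pending payloads with hop count 0, so the center of a ball needs no
    separate treatment. *)
Definition heard_of (s : nstate) (m : msgs) : {set 'I_k.+1 * pay} :=
  [set x | ((x.1 == ord0) && (x.2 \in npend s)) || got m (IPkt x)].

Definition hears (s : nstate) (m : msgs) (p : pay) : bool :=
  [exists j, (j, p) \in heard_of s m].

Definition arrival (s : nstate) (m : msgs) : option (bool * 'I_D) :=
  if nhold s is None then [pick x | ITok x.1 \in m x.2] else None.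

Definition nport (s : nstate) (b : bool) : option 'I_D :=
  tarry_port (nlinks s) (nused s b) (npar s b).

Definition send (s : nstate) : option (bool * 'I_D) :=
  if nhold s is Some (b, q) then
    if q == ord_max then omap (pair b) (nport s b) else None
  else None.

Definition finish (s : nstate) : bool :=
  if nhold s is Some (b, q) then (q == ord_max) && ~~ nport s b else false.

(** The end of a traversal is interpreted by the clock: without a clock it was the first traversal
    and the stages start, with a clock it was the second and the network halts. *)
Definition start_now (s : nstate) (m : msgs) : bool :=
  ~~ nclock s && (finish s || got m IStart).

Definition halt_now (s : nstate) (m : msgs) : bool :=
  (finish s && nclock s) || got m IHalt.

Definition next_hold (s : nstate) (m : msgs) : option (bool * 'I_hmax.+1) :=
  if nhold s is Some (b, q) then
    if q != ord_max then Some (b, inord q.+1)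
    else if nport s b then None
    else if nclock s then nhold s else Some (true, ord0)
  else omap (fun x => (x.1, ord0)) (arrival s m).

Definition next_used (s : nstate) : {ffun bool -> {set 'I_D}} :=
  [ffun b => if send s is Some (b', i)
             then if b == b' then i |: nused s b else nused s b
             else nused s b].

Definition next_par (s : nstate) (m : msgs) : {ffun bool -> option 'I_D} :=
  [ffun b => if arrival s m is Some (b', i)
             then if [&& b == b', ~~ nroot s & npar s b == None]
                  then Some i else npar s b
             else npar s b].

Definition store_now (s : nstate) (m : msgs) : {set C * l.-tuple C} :=
  nstore s :|: [set f | hears s m (PFact f)].

Definition new_facts (s : nstate) (m : msgs) : {set l.-tuple C} :=
  if nclock s == Some ord0 then
    [set g in eval_at phi (nlab s) (nnear s) (nadj s) (store_now s m)
       | (nlab s, g) \notin store_now s m]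
  else set0.

Definition emits_act (s : nstate) (m : msgs) : bool :=
  arrival s m || (finish s && ~~ nclock s).

Definition next_pend (s : nstate) (m : msgs) : {set pay} :=
  [set p : pay | match p with
       | PAct => emits_act s m
       | PBall c => (c == nlab s) && hears s m PAct
       | PNear x => (x.2 == nlab s) && hears s m (PBall x.1)
       | PAdj x => (x.2 == nlab s)
           && [exists j, (nat_of_ord j == 1) && ((j, PBall x.1) \in heard_of s m)]
       | PFact x => (x.1 == nlab s) && (x.2 \in new_facts s m)
       end].

Definition next_clock (s : nstate) (m : msgs) : option 'I_period :=
  if nclock s is Some c then Some (inord (c.+1 %% period))
  else if start_now s m then Some ord0 else None.

(** Pairs are recorded only while the node holds the token: at other times they may answer the
    activation of another node, whose ball can bear the same labels on different nodes. *)
Definition next_state (s : nstate) (m : msgs) : nstate :=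
  NState (nlab s) (nlinks s) (nroot s) (next_hold s m) (next_used s)
    (next_par s m) (next_pend s m)
    (if nhold s then nnear s :|: [set x | hears s m (PNear x)] else nnear s)
    (if nhold s then nadj s :|: [set x | hears s m (PAdj x)] else nadj s)
    (next_clock s m) (store_now s m) (halt_now s m).

Definition next_out (s : nstate) (m : msgs) : msgs :=
  [ffun i => [set f : itm | match f with
     | IPkt x => (0 < x.1) && ((inord x.1.-1, x.2) \in heard_of s m)
     | ITok b => send s == Some (b, i)
     | IStart => start_now s m
     | IHalt => halt_now s m
     end]].

(* The requesting node starts as if the token had just arrived. *)
Definition init_state (c : C) (nb : {ffun 'I_D -> option C}) (b : bool) :
    nstate :=
  NState c [set i | nb i] b (if b then Some (false, ord0) else None)
    [ffun=> set0] [ffun=> None] (if b then [set PAct] else set0)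
    set0 set0 None set0 false.

Definition fixpoint_protocol : protocol C D l :=
  @Protocol C D l nstate itm init_state
    (fun s m => (next_state s m, next_out s m)) nhalt
    (fun s => [set g | (nlab s, g) \in nstore s]).

Lemma got_quiet f : got (quiet D _) f = false.
Proof. by apply/existsP=> -[i]; rewrite ffunE inE. Qed.

Lemma init_quiet c nb :
  pstep (init_state c nb false : pstate fixpoint_protocol) (quiet D _)
  = (init_state c nb false, quiet D _).
Proof.
rewrite /=; set s := init_state c nb false; set m := quiet D _.
have hd x : (x \in heard_of s m) = false.
  by rewrite !inE andbF got_quiet.
have hs p : hears s m p = false.
  by apply/existsP=> -[j]; rewrite hd.
have ar : arrival s m = None.
  by rewrite /arrival /=; case: pickP => // x; rewrite ffunE inE.
have st : start_now s m = false by rewrite /start_now /= got_quiet.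
have ha : halt_now s m = false by rewrite /halt_now /= got_quiet.
congr pair; last first.
  apply/ffunP=> i; rewrite !ffunE; apply/setP=> f; rewrite !inE.
  by case: f => [x|b||] //=; rewrite hd andbF.
rewrite /next_state /next_hold /= ar /= ha /next_clock /= st; congr NState.
- by apply/ffunP=> b; rewrite !ffunE.
- by apply/ffunP=> b; rewrite !ffunE ar.
- apply/setP=> -[|c'|x|x|x]; rewrite !inE /emits_act ?ar ?hs ?andbF //.
  apply/andP=> -[_ /existsP[j]];
  by rewrite hd andbF.
- by apply/setP=> f; rewrite !inE /= hs.
Qed.

End Protocol.

(** * Runs of the protocol on a network *)

Section Execution.

Variables (C : finType) (k D l : nat) (phi : formula l (option 'I_l)).
Variables (N : network C k D) (P : port_numbering N) (r : N).

Notation A := (fixpoint_protocol C k D phi).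
Notation adjN := (@adj C k D N).
Notation ballN := (ball adjN k).
Notation labelN := (@label C k D N).
Notation itm := (item C k l).
Notation pay := (payload C l).
Notation hm := (hmax C k l).
Notation symN := (@adj_sym C k D N).

Definition st (t : nat) (v : N) : nstate C k D l := (prun P A r t v).1.
Definition out (t : nat) (v : N) : {ffun 'I_D -> {set itm}} :=
  (prun P A r t v).2.
Definition ml (t : nat) (v : N) : {ffun 'I_D -> {set itm}} :=
  pmail P (prun P A r t) v.

Lemma st_init v : st 0 v
  = init_state k l (labelN v) [ffun i => omap labelN (port P v i)] (v == r).
Proof. by []. Qed.

Lemma out_init v : out 0 v = quiet D _.
Proof. by []. Qed.

Lemma stS t v : st t.+1 v
  = if nhalt (st t v) then st t v else next_state phi (st t v) (ml t v).
Proof.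
by rewrite /st /ml /= /pround /=; case: ifP.
Qed.

Lemma outS t v : out t.+1 v
  = if nhalt (st t v) then quiet D _ else next_out (st t v) (ml t v).
Proof.
by rewrite /out /st /ml /= /pround /=; case: ifP.
Qed.

Lemma mlP t v i f : reflect
  (exists u j, [/\ port P v i = Some u, port P u j = Some v & f \in out t u j])
  (f \in ml t v i).
Proof.
rewrite ffunE; apply: (iffP idP) => [|[u [j [-> e fo]]]].
  case e: port => [u|]; last by rewrite inE.
  case: pickP => [j /eqP ej fo|_]; last by rewrite inE.
  by exists u, j; split.
by have := back_port e; rewrite /back => ->.
Qed.

Lemma gotP t v f : reflect
  (exists u j, [/\ adjN u v, port P u j = Some v & f \in out t u j])
  (got (ml t v) f).
Proof.
apply: (iffP existsP) => [[i /mlP[u [j [e e' fo]]]]|[u [j [uv e fo]]]].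
  by exists u, j; split=> //; apply: port_linked e'.
have [i _ e'] := backP e; exists i; apply/mlP; exists u, j.
by split.
Qed.

Lemma lab_st t v : nlab (st t v) = labelN v.
Proof. by elim: t => [//|t IH]; rewrite stS; case: ifP. Qed.

Lemma links_st t v : nlinks (st t v) = links P v.
Proof.
elim: t => [|t IH]; last by rewrite stS; case: ifP.
rewrite st_init /=; apply/setP=> i; rewrite !inE ffunE.
by case: port.
Qed.

Lemma root_st t v : nroot (st t v) = (v == r).
Proof. by elim: t => [//|t IH]; rewrite stS; case: ifP. Qed.

(** * Floods *)

Definition hear (t : nat) (v : N) : {set 'I_k.+1 * pay} :=
  if nhalt (st t v) then set0 else heard_of (st t v) (ml t v).

Definition emit (t : nat) (v : N) : {set pay} :=
  if nhalt (st t v) then set0 else npend (st t v).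

Lemma hear0 t v p : ((ord0, p) \in hear t v) = (p \in emit t v).
Proof.
rewrite /hear /emit; case: ifP => _; rewrite !inE //=.
rewrite (_ : got _ _ = false) ?orbF //; apply/gotP => -[u [j [_ _]]].
case: t => [|t]; rewrite ?out_init ?outS ?ffunE ?inE //.
by case: ifP; rewrite ffunE !inE.
Qed.

Lemma hear_next t v (j : 'I_k.+1) p : 0 < j ->
  reflect (exists t' u, [/\ t = t'.+1, ~~ nhalt (st t v), adjN u v
             & (inord j.-1, p) \in hear t' u])
          ((j, p) \in hear t v).
Proof.
move=> j0; rewrite {2}/hear; case: (boolP (nhalt _)) => [hv|hv].
  by rewrite inE; constructor=> -[t' [u []]].
rewrite inE /=; have -> : (j == ord0) = false by apply/eqP=> e; rewrite e in j0.
rewrite /=; apply: (iffP (gotP _ _ _)) => [[u [i [uv e]]]|[t' [u [et _ uv h]]]].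
  case: t hv => [|t] hv; rewrite ?out_init ?outS ?ffunE ?inE //.
  case: ifPn => hu; rewrite ffunE !inE //= j0 /= => h.
  exists t, u; split=> //; rewrite /hear (negbTE hu).
  by rewrite inE.
move: (uv); rewrite (port_adj P) => /existsP[i /eqP e].
exists u, i; split=> //; rewrite et outS; move: h; rewrite /hear.
case: ifPn => hu; rewrite !inE // => h.
by rewrite ffunE !inE /= j0 /=.
Qed.

(** The packet is traced back hop by hop to its source; its hop count is at once the length of a
    walk and the delay. *)
Lemma hear_sound t v (j : 'I_k.+1) p : (j, p) \in hear t v ->
  exists w, [/\ walk adjN j w v, j <= t & p \in emit (t - j) w].
Proof.
move: {2}(nat_of_ord j) (erefl (nat_of_ord j)) => n; elim: n t v j => [|n IH] t v j ej.
  have -> : j = ord0 by apply: val_inj.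
  by rewrite hear0 => h; exists v; rewrite /= eqxx subn0.
have j0 : 0 < j by rewrite ej.
case/(hear_next _ _ _ j0) => t' [u [-> _ uv /IH]].
have e1 : (inord j.-1 : 'I_k.+1) = n :> nat.
  by rewrite inordK ej // -ltnS -ej; apply: leq_trans (ltn_ord j) _.
case=> [//|w [w1 w2 w3]]; exists w; rewrite e1 in w1 w2 w3.
rewrite ej; split=> //.
by rewrite /=; apply/existsP; exists u; rewrite w1.
Qed.

(** Converse of [hear_sound]; it needs running nodes, since a halted one forwards nothing. *)
Lemma hear_complete t v w (j : 'I_k.+1) p :
  (forall s u, s <= t -> ~~ nhalt (st s u)) ->
  walk adjN j w v -> j <= t -> p \in emit (t - j) w -> (j, p) \in hear t v.
Proof.
move: {2}(nat_of_ord j) (erefl (nat_of_ord j)) => n.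
elim: n t v j => [|n IH] t v j ej nh.
  have -> : j = ord0 by apply: val_inj.
  by rewrite hear0 subn0 => /eqP ->.
have j0 : 0 < j by rewrite ej.
rewrite {1 2}ej; case/existsP=> u /andP[wu uv] jt h; case: t nh jt h => // t nh jt h.
apply/hear_next => //; exists t, u; split=> //; first exact: nh.
have e1 : (inord j.-1 : 'I_k.+1) = n :> nat.
  by rewrite inordK ej // -ltnS -ej; apply: leq_trans (ltn_ord j) _.
apply: IH; rewrite ?e1 //.
  by move=> s u' hs; apply: nh; apply: leq_trans hs _.
by rewrite ej subSS in h.
Qed.

(** * The token *)

Definition hold_inv (t : nat) (b : bool) (c : tconf N) (q : nat) : Prop :=
  forall v, [/\ nhold (st t v)
                = if v == tholder c then Some (b, inord q) else None,
                nused (st t v) b = tused c v, npar (st t v) b = tpar c v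
              & forall i b', ITok b' \notin out t v i].

(** While the token is on a link, the sender has already marked its port but the receiver has not
    yet set its parent: hence the ports of c' with the parents of c. *)
Definition moving_inv (t : nat) (b : bool) (c c' : tconf N) (i : 'I_D) : Prop :=
  forall v, [/\ nhold (st t v) = None, nused (st t v) b = tused c' v,
                npar (st t v) b = tpar c v
              & forall j b', (ITok b' \in out t v j)
                             = [&& v == tholder c, j == i & b' == b]].

(** The first traversal has to leave the data of the second untouched and all clocks unset; during
    the second, the running clock of r tells it that the next end is the last. *)
Definition side_inv (t : nat) (b : bool) : Prop :=
  (forall v, ~~ nhalt (st t v) /\ forall i, IHalt \notin out t v i) /\
  if b then is_true (nclock (st t r) : bool)
  else forall v, [/\ nclock (st t v) = None, nused (st t v) true = set0,
                     npar (st t v) true = None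
                   & forall i, IStart \notin out t v i].

Lemma no_got t v f : (forall u i, f \notin out t u i) -> got (ml t v) f = false.
Proof. by move=> no; apply/gotP=> -[u [j [_ _]]]; apply/negP. Qed.

Lemma no_arrival t v : (forall u i b, ITok b \notin out t u i) ->
  arrival (st t v) (ml t v) = None.
Proof.
move=> no; rewrite /arrival; case: nhold => //; case: pickP => // x.
by case/mlP=> u [j [_ _]]; rewrite (negbTE (no _ _ _)).
Qed.

Lemma inord_hmax q : q <= hm -> (inord q : 'I_hm.+1) = q :> nat.
Proof. by move=> h; rewrite inordK. Qed.

Lemma hold_inv_step t b c q : hold_inv t b c q -> side_inv t b -> q < hm ->
  hold_inv t.+1 b c q.+1 /\ side_inv t.+1 b.
Proof.
move=> hi si hq; have [nh sb] := si.
have notok v : arrival (st t v) (ml t v) = None.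
  by apply: no_arrival => u; case: (hi u).
have noth v : got (ml t v) IHalt = false by apply: no_got => u; case: (nh u).
have qm : (inord q == ord_max :> 'I_hm.+1) = false.
  by apply/eqP=> /(congr1 val) /=; rewrite inord_hmax; lia.
have se v : send (st t v) = None.
  by rewrite /send; case: (hi v) => -> _ _ _; case: eqP => //= _; rewrite qm.
have fi v : finish (st t v) = false.
  by rewrite /finish; case: (hi v) => -> _ _ _; case: eqP => //= _; rewrite qm.
have ns v : st t.+1 v = next_state phi (st t v) (ml t v).
  by rewrite stS; case: (nh v) => /negbTE ->.
have no v : out t.+1 v = next_out (st t v) (ml t v).
  by rewrite outS; case: (nh v) => /negbTE ->.
split.
  move=> v; have [e1 e2 e3 e4] := hi v; rewrite ns no; split=> //=.
  - rewrite /next_hold e1; case: eqP => _; last by rewrite notok.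
    by rewrite qm /= inord_hmax // ltnW.
  - by rewrite ffunE se.
  - by rewrite ffunE notok.
  - by move=> i b'; rewrite ffunE inE se.
split.
  move=> v; rewrite ns no /= /halt_now fi noth; split=> // i.
  by rewrite ffunE inE /halt_now fi noth.
case: b sb {hi si} => [sr|sv].
  by rewrite ns /= /next_clock; case: nclock sr.
have nost v : got (ml t v) IStart = false by apply: no_got => u; case: (sv u).
move=> v; have [f1 f2 f3 f4] := sv v.
rewrite ns no /= /next_clock f1 /start_now fi nost andbF !ffunE se notok.
by split=> // i; rewrite ffunE inE /start_now fi nost andbF.
Qed.

Lemma hold_inv_send t b c c' i : hold_inv t b c hm -> side_inv t b ->
  tarry_port (links P (tholder c)) (tused c (tholder c)) (tpar c (tholder c))
    = Some i ->
  (forall v, tused c' v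
     = if v == tholder c then i |: tused c v else tused c v) ->
  moving_inv t.+1 b c c' i /\ side_inv t.+1 b.
Proof.
move=> hi si ti uc; have [nh sb] := si; set h := tholder c in ti uc *.
have notok v : arrival (st t v) (ml t v) = None.
  by apply: no_arrival => u; case: (hi u).
have noth v : got (ml t v) IHalt = false by apply: no_got => u; case: (nh u).
have qm : (inord hm == ord_max :> 'I_hm.+1).
  by apply/eqP; apply: val_inj; rewrite /= inord_hmax.
have np : nport (st t h) b = Some i.
  by rewrite /nport links_st; case: (hi h) => _ -> -> _.
have se v : send (st t v) = if v == h then Some (b, i) else None.
  rewrite /send; case: (hi v) => -> _ _ _; rewrite -/h; case: eqP => //= ->.
  by rewrite qm np.
have fi v : finish (st t v) = false.
  rewrite /finish; case: (hi v) => -> _ _ _; rewrite -/h; case: eqP => //= ->.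
  by rewrite qm np.
have ns v : st t.+1 v = next_state phi (st t v) (ml t v).
  by rewrite stS; case: (nh v) => /negbTE ->.
have no v : out t.+1 v = next_out (st t v) (ml t v).
  by rewrite outS; case: (nh v) => /negbTE ->.
split.
  move=> v; have [e1 e2 e3 e4] := hi v; rewrite ns no; split=> //=.
  - rewrite /next_hold e1 -/h; case: eqP => [->|_]; last by rewrite notok.
    by rewrite qm np.
  - by rewrite ffunE se uc e2; case: (v == h); rewrite ?eqxx.
  - by rewrite ffunE notok.
  - move=> j b'; rewrite ffunE inE se; case: (v == h) => //=.
    by apply/eqP/andP => [[-> ->] //|[/eqP -> /eqP ->]].
split.
  move=> v; rewrite ns no /= /halt_now fi noth; split=> // j.
  by rewrite ffunE inE /halt_now fi noth.
case: b sb se {hi si np} => [sr|sv] se.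
  by rewrite ns /= /next_clock; case: nclock sr.
have nost v : got (ml t v) IStart = false by apply: no_got => u; case: (sv u).
move=> v; have [f1 f2 f3 f4] := sv v.
rewrite ns no /= /next_clock f1 /start_now fi nost andbF !ffunE se notok.
split=> //; first by case: (v == h).
by move=> j; rewrite ffunE inE /start_now fi nost andbF.
Qed.

Lemma moving_inv_arrive t b c c' i w : moving_inv t b c c' i -> side_inv t b ->
  port P (tholder c) i = Some w -> tholder c' = w ->
  (forall v, tpar c' v = if [&& v == w, v != r & tpar c v == None]
                         then back P w (tholder c) else tpar c v) ->
  hold_inv t.+1 b c' 0 /\ side_inv t.+1 b.
Proof.
move=> mi si pw hw pc; have [nh sb] := si; set h := tholder c in pw pc *.
have [j bj pj] := backP pw.
have noth v : got (ml t v) IHalt = false by apply: no_got => u; case: (nh u).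
have tokE v x : (ITok x.1 \in ml t v x.2) = (v == w) && (x == (b, j)).
  apply/mlP/andP => [[u [i' [e e']]]|[/eqP -> /eqP ->]]; last first.
    by exists h, i; case: (mi h) => _ _ _ ->; rewrite !eqxx.
  case: (mi u) => _ _ _ -> /and3P[/eqP uh /eqP ii /eqP eb]; rewrite -/h in uh.
  move: e e'; rewrite uh ii pw => e [wv]; subst v; rewrite eqxx; split=> //.
  by rewrite [x]surjective_pairing eb (port_inj e pj).
have ar v : arrival (st t v) (ml t v) = if v == w then Some (b, j) else None.
  rewrite /arrival; case: (mi v) => -> _ _ _; case: pickP => [x|no].
    by rewrite tokE => /andP[-> /eqP ->].
  by have := no (b, j); rewrite tokE eqxx andbT => ->.
have se v : send (st t v) = None by rewrite /send; case: (mi v) => ->.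
have fi v : finish (st t v) = false by rewrite /finish; case: (mi v) => ->.
have ns v : st t.+1 v = next_state phi (st t v) (ml t v).
  by rewrite stS; case: (nh v) => /negbTE ->.
have no v : out t.+1 v = next_out (st t v) (ml t v).
  by rewrite outS; case: (nh v) => /negbTE ->.
split.
  move=> v; have [e1 e2 e3 e4] := mi v; rewrite ns no; split=> //=.
  - rewrite /next_hold e1 ar hw; case: eqP => //= _; congr (Some (_, _)).
    by apply: val_inj; rewrite /= inord_hmax.
  - by rewrite ffunE se.
  - rewrite ffunE ar pc root_st e3 bj; case: (v == w) => //=.
    by rewrite eqxx /=.
  - by move=> i' b'; rewrite ffunE inE se.
split.
  move=> v; rewrite ns no /= /halt_now fi noth; split=> // i'.
  by rewrite ffunE inE /halt_now fi noth.
case: b sb ar {mi si tokE} => [sr|sv] ar.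
  by rewrite ns /= /next_clock; case: nclock sr.
have nost v : got (ml t v) IStart = false by apply: no_got => u; case: (sv u).
move=> v; have [f1 f2 f3 f4] := sv v.
rewrite ns no /= /next_clock f1 /start_now fi nost andbF !ffunE se ar.
split=> //; first by case: (v == w).
by move=> i'; rewrite ffunE inE /start_now fi nost andbF.
Qed.

Definition one_holder (t : nat) : Prop :=
  (forall u v, nhold (st t u) -> nhold (st t v) -> u = v) /\
  (forall v, finish (st t v) -> v = r).

Lemma hold_inv_one t b c q : tinv P r c -> hold_inv t b c q -> one_holder t.
Proof.
move=> ic hi; split=> [u v|v].
  case: (hi u) (hi v) => -> _ _ _ [-> _ _ _].
  by case: eqP => // -> _; case: eqP.
rewrite /finish; case: (hi v) => -> e2 e3 _; case: eqP => // ev /andP[_].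
rewrite /nport links_st e2 e3 ev => np.
have : tnext P r c = None by rewrite /tnext; case: tarry_port np.
by case/(stuck_all_visited ic).
Qed.

Lemma hold_inv_turn t b c : hold_inv t b c 0 -> side_inv t b ->
  forall q, q <= hm -> hold_inv (t + q) b c q /\ side_inv (t + q) b.
Proof.
move=> hi si; elim=> [|q IH] hq; first by rewrite addn0.
by have [h s] := IH (ltnW hq); rewrite addnS; apply: hold_inv_step.
Qed.

Lemma hold_inv_next t b c c' : tinv P r c -> tnext P r c = Some c' ->
  hold_inv t b c hm -> side_inv t b ->
  [/\ one_holder t.+1, side_inv t.+1 b, hold_inv t.+2 b c' 0 & side_inv t.+2 b].
Proof.
move=> ic nc hi si; have [i [w [ti pw ec]]] := tnextP ic nc.
have [|mi si'] := hold_inv_send (c' := c') hi si ti; first by rewrite ec.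
have [||hi' si''] := moving_inv_arrive mi si' pw; [by rewrite ec|by rewrite ec|].
split=> //; split=> [u v|v]; first by case: (mi u) => ->.
by rewrite /finish; case: (mi v) => ->.
Qed.

(** [hm] rounds to fill the counter of the holder, one to send the token and one to receive it. *)
Notation turn := hm.+2.

(** The i-th configuration of the abstract trajectory is reached at time [t0 + i * turn]. *)
Lemma traversal t0 b : hold_inv t0 b (tinit r) 0 -> side_inv t0 b ->
  exists m, let tE := t0 + m * turn + hm in
  [/\ (m <= #|N| * D) && (#|N| <= m.+1),
      forall t, t0 <= t <= tE -> side_inv t b /\ one_holder t,
      exists2 c, hold_inv tE b c hm & tnext P r c = None /\ tinv P r c &
      forall v, exists t,
        [/\ t0 <= t, t + hm <= tE & nhold (st t v) = Some (b, ord0)]].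
Proof.
move=> hi si; have [m [bounds steps stuck hr hv]] := tarry_total P r.
have main i : i <= m -> hold_inv (t0 + i * turn) b (traj P r i) 0
    /\ forall t, t0 <= t <= t0 + i * turn -> side_inv t b /\ one_holder t.
  elim: i => [_|i IH hm'].
    rewrite mul0n addn0; split=> // t; rewrite -eqn_leq => /eqP <-.
    by split=> //; apply: hold_inv_one hi; apply: tinv_init.
  have [h1 h2] := IH (ltnW hm').
  have [s1 _] : side_inv (t0 + i * turn) b /\ one_holder (t0 + i * turn).
    by apply: h2; rewrite leq_addr leqnn.
  have tn := hold_inv_turn h1 s1.
  have [h3 s3] := tn hm (leqnn _).
  have [o4 s4 h5 s5] := hold_inv_next (tinv_traj P r i) (steps i hm') h3 s3.
  have e5 : (t0 + i * turn + hm).+2 = t0 + i.+1 * turn by lia.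
  rewrite e5 in h5 s5; split=> // t /andP[tl tr].
  have [tA|tA] := leqP t (t0 + i * turn); first by apply: h2; rewrite tl.
  have [tB|tB] := leqP t (t0 + i * turn + hm).
    have [h6 s6] := tn (t - (t0 + i * turn)) ltac:(lia).
    rewrite subnKC in h6 s6; last exact: ltnW.
    by split=> //; apply: hold_inv_one h6; apply: tinv_traj.
  have [->|ne] := eqVneq t (t0 + i * turn + hm).+1; first by [].
  have -> : t = t0 + i.+1 * turn by move/eqP: ne; lia.
  by split=> //; apply: hold_inv_one h5; apply: (tinv_traj P r i.+1).
exists m => /=; have [h1 h2] := main m (leqnn _).
have [s1 _] : side_inv (t0 + m * turn) b /\ one_holder (t0 + m * turn).
  by apply: h2; rewrite leq_addr leqnn.
have tn := hold_inv_turn h1 s1.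
split=> //.
- move=> t /andP[tl tr].
  have [tA|tA] := leqP t (t0 + m * turn); first by apply: h2; rewrite tl.
  have [h6 s6] := tn (t - (t0 + m * turn)) ltac:(lia).
  rewrite subnKC in h6 s6; last exact: ltnW.
  by split=> //; apply: hold_inv_one h6; apply: tinv_traj.
- exists (traj P r m); first by case: (tn hm (leqnn _)).
  by split=> //; apply: tinv_traj.
- move=> v; have [i im ei] := hv v; exists (t0 + i * turn).
  have : i * turn <= m * turn by rewrite leq_mul2r im orbT.
  split; [lia|lia|]; have [h6 _] := main i im.
  case: (h6 v) => -> _ _ _; rewrite -ei eqxx; congr (Some (_, _)).
  by apply: val_inj; rewrite /= inord_hmax.
Qed.

Lemma stuck_finish t b c : hold_inv t b c hm -> side_inv t b ->
  tnext P r c = None -> tinv P r c ->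
  [/\ tholder c = r, forall v, finish (st t v) = (v == r),
      forall v, send (st t v) = None, nport (st t r) b = None
    & forall v, arrival (st t v) (ml t v) = None].
Proof.
move=> hi si nc ic; have [hr _] := stuck_all_visited ic nc.
have qm : (inord hm == ord_max :> 'I_hm.+1).
  by apply/eqP; apply: val_inj; rewrite /= inord_hmax.
have np : nport (st t r) b = None.
  rewrite /nport links_st; case: (hi r) => _ -> -> _.
  by have := tnext_none ic nc; rewrite hr.
split=> // v.
- rewrite /finish; case: (hi v) => -> _ _ _; rewrite hr.
  by case: eqP => //= ->; rewrite qm np.
- rewrite /send; case: (hi v) => -> _ _ _; rewrite hr.
  by case: eqP => //= ->; rewrite qm np.
by apply: no_arrival => u; case: (hi u).
Qed.

Lemma switch_run t c : hold_inv t false c hm -> side_inv t false ->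
  tnext P r c = None -> tinv P r c ->
  [/\ hold_inv t.+1 true (tinit r) 0, side_inv t.+1 true,
      forall v, nclock (st t.+1 v) = if v == r then Some ord0 else None
    & forall v i, (IStart \in out t.+1 v i) = (v == r)].
Proof.
move=> hi si nc ic; have [hr fi se np ar] := stuck_finish hi si nc ic.
have [nh sv] := si; rewrite /= in sv.
have qm : (inord hm == ord_max :> 'I_hm.+1).
  by apply/eqP; apply: val_inj; rewrite /= inord_hmax.
have ns v : st t.+1 v = next_state phi (st t v) (ml t v).
  by rewrite stS; case: (nh v) => /negbTE ->.
have no v : out t.+1 v = next_out (st t v) (ml t v).
  by rewrite outS; case: (nh v) => /negbTE ->.
have noth v : got (ml t v) IHalt = false by apply: no_got => u; case: (nh u).
have nost v : got (ml t v) IStart = false by apply: no_got => u; case: (sv u).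
have ha v : halt_now (st t v) (ml t v) = false.
  by rewrite /halt_now noth; case: (sv v) => ->; rewrite andbF.
have sn v : start_now (st t v) (ml t v) = (v == r).
  by rewrite /start_now nost fi orbF; case: (sv v) => ->.
have cl v : nclock (st t.+1 v) = if v == r then Some ord0 else None.
  by rewrite ns /= /next_clock; case: (sv v) => -> _ _ _; rewrite sn.
split=> //.
- move=> v; have [e1 e2 e3 e4] := hi v; have [f1 f2 f3 f4] := sv v.
  rewrite ns no /=; split.
  + rewrite /next_hold e1 hr; case: eqP => [->|_] /=; last by rewrite ar.
    rewrite qm np /=; case: (sv r) => -> _ _ _; congr (Some (_, _)).
    by apply: val_inj; rewrite /= inord_hmax.
  + by rewrite ffunE se f2.
  + by rewrite ffunE ar f3.
  + by move=> i b'; rewrite ffunE inE se.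
- split; last by rewrite /= cl eqxx.
  by move=> v; rewrite ns no /= ha; split=> // i; rewrite ffunE inE ha.
- by move=> v i; rewrite no ffunE inE sn.
Qed.

Lemma final_run t c : hold_inv t true c hm -> side_inv t true ->
  tnext P r c = None -> tinv P r c ->
  [/\ forall v, nhalt (st t.+1 v) = (v == r),
      forall v i, (IHalt \in out t.+1 v i) = (v == r),
      forall v, v != r -> nhold (st t.+1 v) = None
    & forall v i b, ITok b \notin out t.+1 v i].
Proof.
move=> hi si nc ic; have [hr fi se np ar] := stuck_finish hi si nc ic.
have [nh sr] := si; rewrite /= in sr.
have ns v : st t.+1 v = next_state phi (st t v) (ml t v).
  by rewrite stS; case: (nh v) => /negbTE ->.
have no v : out t.+1 v = next_out (st t v) (ml t v).
  by rewrite outS; case: (nh v) => /negbTE ->.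
have ha v : halt_now (st t v) (ml t v) = (v == r).
  rewrite /halt_now fi (_ : got _ _ = false); last first.
    by apply: no_got => u; case: (nh u).
  by case: eqP => //= ->; rewrite sr.
split=> v; rewrite ?ns ?no //=.
- by move=> i; rewrite ffunE inE ha.
- move=> vr; rewrite /next_hold; case: (hi v) => -> _ _ _.
  by rewrite hr (negbTE vr) ar.
- by move=> i b; rewrite ffunE inE se.
Qed.

(** [tS] is the round in which r starts its clock and [t1] the one in which it halts. [tl_long]
    leaves room for all stages, and [tl_bound] is the source of the linear running time. *)
Record timeline (tS t1 : nat) : Prop := Timeline {
  tl_running : forall t v, t < t1 -> ~~ nhalt (st t v);
  tl_one : forall t, t < t1 -> one_holder t;
  tl_turn : forall v, exists t b,
    t + hm < tS /\ nhold (st t v) = Some (b, ord0);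
  tl_unstarted : forall t v, t < tS -> nclock (st t v) = None;
  tl_start : forall v, nclock (st tS v) = if v == r then Some ord0 else None;
  tl_start_out : forall v i, (IStart \in out tS v i) = (v == r);
  tl_halt : forall v, nhalt (st t1 v) = (v == r);
  tl_halt_out : forall v i, (IHalt \in out t1 v i) = (v == r);
  tl_token : forall v, v != r -> nhold (st t1 v) = None;
  tl_token_out : forall v i b, ITok b \notin out t1 v i;
  tl_long : tS + #|N| * hm < t1;
  tl_bound : t1 <= (2 * D.+1 * hm.+2) * #|N| }.

(** First traversal, switch, second traversal, halt. A traversal visits every node, so it has at
    least [#|N|] turns, whence [tl_long]; it makes at most [#|N| * D] moves, whence [tl_bound]. *)
Lemma timeline_exists : exists tS t1, timeline tS t1.
Proof.
have hi0 : hold_inv 0 false (tinit r) 0.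
  move=> v; rewrite st_init out_init /= !ffunE; split=> //.
    case: (v == r) => //; congr (Some (_, _)).
    by apply: val_inj; rewrite /= inord_hmax.
  by move=> i b; rewrite ffunE inE.
have si0 : side_inv 0 false.
  split=> v; rewrite st_init out_init /= ?ffunE; split=> // i;
    by rewrite ffunE inE.
have [m0 /= [/andP[b1 b2] ok0 [c0 hc0 [nc0 ic0]] tv]] := traversal hi0 si0.
set tE := 0 + m0 * turn + hm in ok0 hc0 tv *.
have [|s0 _] := ok0 tE; first by rewrite leqnn.
have [hi1 si1 cl so] := switch_run hc0 s0 nc0 ic0.
have [m1 /= [/andP[b3 b4] ok1 [c1 hc1 [nc1 ic1]] _]] := traversal hi1 si1.
set tF := tE.+1 + m1 * turn + hm in ok1 hc1 *.
have [|s1 _] := ok1 tF; first by rewrite leqnn andbT /tF; lia.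
have [h1 h2 h3 h4] := final_run hc1 s1 nc1 ic1.
exists tE.+1, tF.+1; split=> //.
- move=> t v lt; case: (leqP t tE) => tE'.
    by have [[] /(_ v)[]] := ok0 t tE'.
  by have [|[] /(_ v)[]] := ok1 t; first by rewrite tE'.
- move=> t lt; case: (leqP t tE) => tE'.
    by have [_] := ok0 t tE'.
  by have [|_] := ok1 t; first by rewrite tE'.
- move=> v; have [t [_ tt ht]] := tv v; exists t, false; split=> //.
- move=> t v lt; have [|[_ /(_ v)[]]] := ok0 t => //.
- rewrite /tF; have : #|N| * hm <= m1.+1 * hm by rewrite leq_mul2r b4 orbT.
  move: (#|N| * hm) => X; lia.
rewrite /tF /tE; have n0 : 0 < #|N| by apply/card_gt0P; exists r.
have : m0 * turn <= #|N| * D * turn by rewrite leq_mul2r b1 orbT.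
have : m1 * turn <= #|N| * D * turn by rewrite leq_mul2r b3 orbT.
have : hm.+1 <= #|N| * turn by apply: (@leq_trans (1 * turn)); [lia|rewrite leq_mul2r n0 orbT].
have -> : 2 * D.+1 * hm.+2 * #|N| = 2 * (#|N| * D * hm.+2) + 2 * (#|N| * hm.+2).
  by lia.
move: (#|N| * D * hm.+2) (#|N| * hm.+2) => X Y; lia.
Qed.

(** * Origins of activations and of the reactions to them *)

Variables tS t1 : nat.
Hypothesis tl : timeline tS t1.

Lemma running_st t v : t < t1 -> st t.+1 v = next_state phi (st t v) (ml t v).
Proof. by move=> lt; rewrite stS (negbTE (tl_running tl v lt)). Qed.

Lemma running_out t v : t < t1 -> out t.+1 v = next_out (st t v) (ml t v).
Proof. by move=> lt; rewrite outS (negbTE (tl_running tl v lt)). Qed.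

Lemma hmax_ge : 3 * k + 3 <= hm.
Proof. by rewrite /hmax -addnA leq_addl. Qed.

Lemma hmax_gt0 : 0 < hm.
Proof. by apply: leq_trans hmax_ge; rewrite addnS. Qed.

(** The counter is 0 only initially at r, on arrival of the token, or when r begins the second
    traversal, which are the moments of activation. *)
Lemma act_hold t v : t <= t1 ->
  (PAct \in npend (st t v)) = (if nhold (st t v) is Some (_, q) then q == ord0 else false).
Proof.
case: t => [_|t lt]; first by rewrite st_init /=; case: eqP => _; rewrite !inE.
rewrite running_st //= inE /emits_act /next_hold /arrival /finish.
case: nhold => [[b q]|]; last first.
  by rewrite orbF; case: pickP.
rewrite /=; case: (eqVneq q ord_max) => [->|ne] /=; last first.
  apply/esym/eqP=> /(congr1 val) /=; rewrite inordK //.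
  by rewrite ltnS ltn_neqAle -ltnS ltn_ord andbT; apply: contra ne => /eqP e; apply/eqP/val_inj.
by case: nport => //=; case: nclock => //= _; rewrite -val_eqE /= gtn_eqF ?hmax_gt0.
Qed.

Lemma hold_persist t v b q : nhold (st t v) = Some (b, ord0) -> q <= hm ->
  t + q <= t1 -> nhold (st (t + q) v) = Some (b, inord q).
Proof.
move=> h0; elim: q => [|q IH] hq lt.
  rewrite addn0 h0; congr (Some (_, _)).
  by apply: val_inj; rewrite /= inord_hmax.
rewrite addnS in lt *; rewrite running_st //= /next_hold IH ?(ltnW hq) ?(ltnW lt) //.
have -> : (inord q == ord_max :> 'I_hm.+1) = false.
  by apply/eqP=> /(congr1 val) /=; rewrite inord_hmax; lia.
by rewrite /= inord_hmax // ltnW.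
Qed.

(** The source of an activation at most [hm] rounds old still holds the token, and there is only one
    holder. *)
Lemma act_unique t s u v : PAct \in emit s u -> s <= t <= s + hm -> t < t1 ->
  nhold (st t v) -> u = v.
Proof.
rewrite /emit; case: ifP => _; rewrite ?inE // => ha /andP[st1 st2] lt hv.
have := act_hold u (ltnW (leq_ltn_trans st1 lt)); rewrite ha.
case hu: nhold => [[b q]|] // /esym /eqP q0; rewrite q0 in hu.
have [one _] := tl_one tl lt; apply: one => //.
by rewrite -(subnKC st1) (hold_persist hu) //; lia.
Qed.

Lemma mem_emitS s v p : p \in emit s.+1 v ->
  ~~ nhalt (st s v) /\ p \in next_pend phi (st s v) (ml s v).
Proof.
rewrite /emit stS; case: (boolP (nhalt (st s v))) => [->|_]; first by rewrite inE.
by case: ifP; rewrite ?inE.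
Qed.

Lemma emit0 v p : p \in emit 0 v -> p = PAct.
Proof.
rewrite /emit st_init /=; case: (v == r); rewrite !inE //.
by move/eqP.
Qed.

Lemma mem_emit s v p : s < t1 -> (p \in emit s v) = (p \in npend (st s v)).
Proof. by move=> lt; rewrite /emit (negbTE (tl_running tl v lt)). Qed.

Lemma hearsE s v p : ~~ nhalt (st s v) ->
  hears (st s v) (ml s v) p = [exists j, (j, p) \in hear s v].
Proof. by move=> nh; rewrite /hears /hear (negbTE nh). Qed.

Lemma emit_ballP t v c : PBall c \in emit t v ->
  exists s j, [/\ t = s.+1, c = labelN v & (j, PAct) \in hear s v].
Proof.
case: t => [/emit0 //|s /mem_emitS[nh]]; rewrite inE hearsE // lab_st.
by case/andP=> /eqP -> /existsP[j h]; exists s, j.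
Qed.

Lemma emit_nearP t v x : PNear x \in emit t v ->
  exists s j, [/\ t = s.+1, x.2 = labelN v & (j, PBall x.1) \in hear s v].
Proof.
case: t => [/emit0 //|s /mem_emitS[nh]]; rewrite inE hearsE // lab_st.
by case/andP=> /eqP -> /existsP[j h]; exists s, j.
Qed.

Lemma emit_adjP t v x : PAdj x \in emit t v ->
  exists s (j : 'I_k.+1), [/\ t = s.+1, x.2 = labelN v, j = 1 :> nat
              & (j, PBall x.1) \in hear s v].
Proof.
case: t => [/emit0 //|s /mem_emitS[nh]]; rewrite inE lab_st.
case/andP=> /eqP -> /existsP[j /andP[/eqP j1 h]]; exists s, j.
by rewrite /hear (negbTE nh).
Qed.

(** * Learning the balls *)

(* The tree of reactions heard by the token holder v has its root in v itself:
   the last activation lies at most 3k + 2 rounds in the past. *)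
Lemma ball_origin t s v (j : 'I_k.+1) c u : t < t1 -> nhold (st t v) ->
  (j, PBall c) \in hear s u -> s <= t -> t <= s + k.+1 ->
  exists b, [/\ b \in ballN v, c = labelN b, walk adjN j b u & b \in ballN u].
Proof.
move=> lt hv /hear_sound[w [w1 w2 w3]] le1 le2.
have [s' [j' [es -> /hear_sound[a [a1 a2 a3]]]]] := emit_ballP w3.
have hk := ltn_ord j; have hk' := ltn_ord j'.
have e : a = v.
  by apply: act_unique a3 _ lt hv; have := hmax_ge; lia.
exists w; split=> //; first by rewrite -e; apply/ballP; exists j'; rewrite // -ltnS.
by apply/ballP; exists j; [rewrite -ltnS|rewrite (walk_sym symN)].
Qed.

Lemma near_sound t v : t <= t1 -> nnear (st t v) \subset near_spec v.
Proof.
elim: t => [|t IH] lt; first by rewrite st_init sub0set.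
rewrite running_st //=; case: ifP => hv; last exact: IH (ltnW lt).
rewrite subUset (IH (ltnW lt)) /=; apply/subsetP=> -[x1 x2].
rewrite inE hearsE ?(tl_running tl) // => /existsP[j].
case/hear_sound=> c [c1 c2 /emit_nearP[s [j' [es /= -> hb]]]].
have hk := ltn_ord j.
have [||b [b1 -> b2 b3]] := ball_origin lt hv hb; [lia|lia|].
rewrite inE; apply/existsP; exists b; rewrite b1 /=.
apply/existsP; exists c; rewrite [c \in ballN b](ball_sym symN) b3 eqxx andbT /= andbT.
by rewrite (ball_sym symN); apply/ballP; exists j; rewrite // -ltnS.
Qed.

Lemma adj_sound t v : t <= t1 -> nadj (st t v) \subset adj_spec v.
Proof.
elim: t => [|t IH] lt; first by rewrite st_init sub0set.
rewrite running_st //=; case: ifP => hv; last exact: IH (ltnW lt).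
rewrite subUset (IH (ltnW lt)) /=; apply/subsetP=> -[x1 x2].
rewrite inE hearsE ?(tl_running tl) // => /existsP[j].
case/hear_sound=> c [c1 c2 /emit_adjP[s [j' [es /= -> j1 hb]]]].
have hk := ltn_ord j.
have [||b [b1 -> b2 b3]] := ball_origin lt hv hb; [lia|lia|].
have bc : adjN b c by move: b2; rewrite j1 walk1.
rewrite inE; apply/existsP; exists b; rewrite b1 /=.
apply/existsP; exists c; rewrite bc eqxx andbT /= andbT.
by rewrite (ball_sym symN); apply/ballP; exists j; rewrite // -ltnS.
Qed.

Lemma tS_lt_t1 : tS < t1.
Proof. by apply: leq_trans (tl_long tl); rewrite ltnS leq_addr. Qed.

Lemma near_mono t d v : t + d <= t1 -> nnear (st t v) \subset nnear (st (t + d) v).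
Proof.
elim: d => [|d IH] lt; first by rewrite addn0.
rewrite addnS in lt *; apply: subset_trans (IH (ltnW lt)) _.
by rewrite running_st //=; case: ifP => _; rewrite // subsetUl.
Qed.

Lemma adj_mono t d v : t + d <= t1 -> nadj (st t v) \subset nadj (st (t + d) v).
Proof.
elim: d => [|d IH] lt; first by rewrite addn0.
rewrite addnS in lt *; apply: subset_trans (IH (ltnW lt)) _.
by rewrite running_st //=; case: ifP => _; rewrite // subsetUl.
Qed.

Lemma running_upto t : t < t1 -> forall s u, s <= t -> ~~ nhalt (st s u).
Proof. by move=> lt s u le; apply: (tl_running tl); apply: leq_ltn_trans lt. Qed.

Lemma hear_from s u w (j : 'I_k.+1) p : s + j < t1 -> p \in npend (st s u) ->
  walk adjN j u w -> (j, p) \in hear (s + j) w.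
Proof.
move=> lt hp wk; apply: hear_complete wk _ _; rewrite ?leq_addl //.
  exact: running_upto.
by rewrite addnK mem_emit // (leq_ltn_trans (leq_addr j s)).
Qed.

Lemma hears_exists s v j p : s < t1 -> (j, p) \in hear s v ->
  hears (st s v) (ml s v) p.
Proof.
by move=> lt h; rewrite hearsE ?(tl_running tl) //; apply/existsP; exists j.
Qed.

Lemma ball_emission v b t0 x0 : nhold (st t0 v) = Some (x0, ord0) -> t0 + hm < tS ->
  b \in ballN v ->
  exists2 s, t0 < s <= t0 + k.+1 & PBall (labelN b) \in npend (st s b).
Proof.
move=> h0 lt0 /ballP[j jk wj]; have ltS := tS_lt_t1; have hk := hmax_ge.
have ha : PAct \in npend (st t0 v) by rewrite act_hold; [rewrite h0|lia].
have lt1 : t0 + j < t1 by lia.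
exists (t0 + j).+1; first lia.
rewrite running_st // inE lab_st eqxx /=.
exact: (hears_exists lt1 (@hear_from t0 v b (Ordinal (jk : j < k.+1)) _ lt1 ha wj)).
Qed.

Lemma turn_recording v t0 x0 s : nhold (st t0 v) = Some (x0, ord0) -> t0 + hm < tS ->
  t0 <= s <= t0 + hm -> nhold (st s v).
Proof.
move=> h0 lt0 /andP[le1 le2]; have ltS := tS_lt_t1.
by rewrite -(subnKC le1) (hold_persist h0) //; lia.
Qed.

(** Within a turn of v, b announces itself at most k + 1 rounds after the activation, c reports the
    pair at most k + 1 rounds later, and the report needs at most k more: 3k + 2 rounds, less than
    [hmax]. *)
Lemma near_complete t v : tS <= t <= t1 -> near_spec v \subset nnear (st t v).
Proof.
move=> /andP[le1 le2]; have [t0 [b0 [lt0 h0]]] := tl_turn tl v.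
have hk := hmax_ge; have ltS := tS_lt_t1.
apply/subsetP=> x; rewrite inE => /existsP[b /andP[hb /existsP[c /and3P[hc hbc]]]].
move=> /eqP -> {x}.
have [s /andP[hs1 hs2] pb] := ball_emission h0 lt0 hb.
have [j2 j2k w2] := ballP _ _ _ _ hbc.
have [j3 j3k w3] := ballP _ _ _ _ hc; rewrite (walk_sym symN) in w3.
have lt2 : s + j2 < t1 by lia.
have h2 := @hear_from s b c (Ordinal (j2k : j2 < k.+1)) _ lt2 pb w2.
have pn : PNear (labelN b, labelN c) \in npend (st (s + j2).+1 c).
  by rewrite running_st // inE lab_st eqxx /=; exact: (hears_exists lt2 h2).
have lt3 : (s + j2).+1 + j3 < t1 by lia.
have h3 := @hear_from _ c v (Ordinal (j3k : j3 < k.+1)) _ lt3 pn w3.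
have le3 : ((s + j2).+1 + j3).+1 <= t by lia.
have sub := @near_mono ((s + j2).+1 + j3).+1 (t - ((s + j2).+1 + j3).+1) v.
rewrite subnKC // in sub; apply: (subsetP (sub le2)).
rewrite running_st //= (turn_recording h0 lt0); last lia.
by rewrite inE [X in _ || X]inE (hears_exists lt3 h3) orbT.
Qed.

Lemma adj_complete t v : tS <= t <= t1 -> adj_spec v \subset nadj (st t v).
Proof.
move=> /andP[le1 le2]; have [t0 [b0 [lt0 h0]]] := tl_turn tl v.
have hk := hmax_ge; have ltS := tS_lt_t1.
apply/subsetP=> x; rewrite inE => /existsP[b /andP[hb /existsP[c /and3P[hc hbc]]]].
move=> /eqP -> {x}.
have [s /andP[hs1 hs2] pb] := ball_emission h0 lt0 hb.
(* For k = 0 the ball has a single node and no adjacent pair, so 1 is a legal hop count here. *)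
have k1 : 1 <= k.
  have [j jk w] := ballP _ _ _ _ hb; have [j' jk' w'] := ballP _ _ _ _ hc.
  rewrite lt0n; apply/eqP=> k0; rewrite k0 !leqn0 in jk jk'.
  move/eqP: jk w => -> /eqP e; move/eqP: jk' w' => -> /eqP e'.
  by move: hbc; rewrite -e -e' adj_irr.
have w2 : walk adjN 1 b c by rewrite walk1.
have [j3 j3k w3] := ballP _ _ _ _ hc; rewrite (walk_sym symN) in w3.
have lt2 : s + 1 < t1 by lia.
have h2 := @hear_from s b c (Ordinal (k1 : 1 < k.+1)) _ lt2 pb w2.
have pn : PAdj (labelN b, labelN c) \in npend (st (s + 1).+1 c).
  rewrite running_st // inE lab_st eqxx /=; apply/existsP; eexists.
  apply/andP; split; last first.
    by move: h2; rewrite /hear (negbTE (tl_running tl c lt2)); apply.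
  by [].
have lt3 : (s + 1).+1 + j3 < t1 by lia.
have h3 := @hear_from _ c v (Ordinal (j3k : j3 < k.+1)) _ lt3 pn w3.
have le3 : ((s + 1).+1 + j3).+1 <= t by lia.
have sub := @adj_mono ((s + 1).+1 + j3).+1 (t - ((s + 1).+1 + j3).+1) v.
rewrite subnKC // in sub; apply: (subsetP (sub le2)).
rewrite running_st //= (turn_recording h0 lt0); last lia.
by rewrite inE [X in _ || X]inE (hears_exists lt3 h3) orbT.
Qed.

Lemma near_exact t v : tS <= t <= t1 -> nnear (st t v) = near_spec v.
Proof.
move=> h; apply/eqP; rewrite eqEsubset near_complete // near_sound //.
by case/andP: h.
Qed.

Lemma adj_exact t v : tS <= t <= t1 -> nadj (st t v) = adj_spec v.
Proof.
move=> h; apply/eqP; rewrite eqEsubset adj_complete // adj_sound //.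
by case/andP: h.
Qed.

(** * Clocks *)

Notation distr := (dist (@adj_connected C k D N) r).
Notation per := (period k).

Lemma inord_period q : (inord (q %% per) : 'I_per) = q %% per :> nat.
Proof. by rewrite inordK // ltn_mod. Qed.

(** Distances of neighbours from r differ by at most one, so beyond distance d a wave sent by layer
    d reaches exactly layer d + 1. *)
Lemma flood_next (f : itm) t d v : (forall u i, (f \in out t u i) = (distr u == d)) ->
  d < distr v -> got (ml t v) f = (distr v == d.+1).
Proof.
move=> fo dv; apply/gotP/eqP => [[u [j [uv e]]]|e].
  rewrite fo => /eqP du.
  have w : walk adjN 1 u v by rewrite walk1.
  by have := dist_walk (@adj_connected C k D N) r w; rewrite du; lia.
have [u uv du] := dist_pred e.
move: (uv); rewrite (port_adj P) => /existsP[i /eqP ei].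
by exists u, i; rewrite fo du eqxx.
Qed.

(** The start signal is a breadth-first wave, so v starts [distr v] rounds after r and counts from
    there modulo the period. *)
Lemma clock_spec d v : tS + d <= t1 ->
  nclock (st (tS + d) v)
    = (if distr v <= d then Some (inord ((d - distr v) %% per)) else None)
  /\ forall i, (IStart \in out (tS + d) v i) = (distr v == d).
Proof.
elim: d v => [|d IH] v lt.
  rewrite addn0 (tl_start tl) leqn0 dist_eq0 eq_sym; split.
    by case: eqP => // ->; congr Some; apply: val_inj; rewrite /= sub0n inord_period mod0n.
  by move=> i; rewrite (tl_start_out tl).
rewrite addnS in lt *; have IHd u := IH u (ltnW lt).
have [c1 _] := IHd v.
have sn : start_now (st (tS + d) v) (ml (tS + d) v) = (distr v == d.+1).
  rewrite /start_now c1; case: leqP => /= [le|gt].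
    by apply/esym/eqP; lia.
  rewrite (@flood_next _ _ d) //; last by move=> u i; case: (IHd u).
  (* The end of a traversal could also start a clock, but it happens only at r, which lies within
     distance d. *)
  case: (boolP (finish _)) => //= fi.
  have [_ /(_ v fi) vr] := tl_one tl lt.
  by move: gt; rewrite vr (eqP (_ : distr r == 0)) ?dist_eq0.
split; last by move=> i; rewrite running_out // ffunE inE sn.
rewrite running_st //= /next_clock c1 sn; case: leqP => le.
  rewrite leqW //; congr Some; apply: val_inj; rewrite /= !inord_period.
  by rewrite subSn // -[in LHS]addn1 modnDml addn1.
case: eqP => [->|ne]; last by rewrite leqNgt ltn_neqAle eq_sym le andbT; case: eqP.
by rewrite leqnn subnn mod0n; congr Some; apply: val_inj; rewrite /= inordK.
Qed.

Lemma clock0P t v : t <= t1 ->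
  reflect (exists i, t = tS + distr v + i * per) (nclock (st t v) == Some ord0).
Proof.
move=> lt; have [ltS|leS] := ltnP t tS.
  rewrite (tl_unstarted tl v ltS); constructor=> -[i e].
  by move: ltS; rewrite e -addnA ltnNge leq_addr.
have := @clock_spec (t - tS) v; rewrite subnKC // => /(_ lt)[-> _].
case: leqP => le; last first.
  by constructor=> -[i e]; move: le; rewrite e -addnA addKn ltnNge leq_addr.
apply: (iffP eqP) => [[]/(congr1 val) /=|[i e]].
  rewrite inord_period => m0; exists ((t - tS - distr v) %/ per).
  by have := divn_eq (t - tS - distr v) per; rewrite m0; lia.
congr Some; apply: val_inj; rewrite /= inord_period.
have -> : t - tS - distr v = i * per by lia.
exact: modnMl.
Qed.

(** * Stages *)

Notation stageN := (stage adjN k phi).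
Notation lastN := (#|N| * #|{: l.-tuple C}|).

Lemma first_stage i t : t \in stageN i ->
  exists2 i', i' < i & t \in stageN i'.+1 :\: stageN i'.
Proof.
elim: i => [|i IH]; first by rewrite inE.
have [ti _|nti ti] := boolP (t \in stageN i).
  by have [i' lt h] := IH ti; exists i' => //; apply: ltnW.
by exists i => //; rewrite inE nti.
Qed.

(** The intended schedule: the tuples that are new in stage i + 1 become pending one round after
    evaluation number i, counted from 0. *)
Definition fact_at (t : nat) (v : N) (f : C * l.-tuple C) : Prop :=
  exists i (b : l.-tuple N),
    [/\ t = (tS + distr v + i * per).+1, f = (labelN v, map_tuple labelN b)
      & (v, b) \in stageN i.+1 :\: stageN i].

Lemma mem_store t v f : t <= t1 ->
  f \in nstore (st t v) <-> exists s j, s < t /\ (j, PFact f) \in hear s v.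
Proof.
elim: t => [|t IH] lt; first by rewrite st_init inE; split=> // -[s [j []]].
rewrite running_st //= inE [X in _ || X]inE; split=> [/orP[/(IH (ltnW lt))|]|].
- by case=> s [j [ls h]]; exists s, j; split=> //; apply: ltnW.
- by rewrite hearsE ?(tl_running tl) // => /existsP[j h]; exists t, j.
case=> s [j []]; rewrite ltnS leq_eqVlt => /orP[/eqP ->|ls] h.
  by rewrite (hears_exists lt h) orbT.
by apply/orP; left; apply/(IH (ltnW lt)); exists s, j.
Qed.

Lemma mem_store_now t v f : t < t1 ->
  f \in store_now (st t v) (ml t v)
  <-> exists s j, s <= t /\ (j, PFact f) \in hear s v.
Proof.
move=> lt; rewrite -(@mem_store t.+1) // running_st //=.
Qed.

Lemma hear_fact t v f : t < t1 ->
  (forall s u, s <= t -> PFact f \in npend (st s u) <-> fact_at s u f) ->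
  (exists j, (j, PFact f) \in hear t v)
  <-> exists w j, [/\ walk adjN j w v, j <= k, j <= t & fact_at (t - j) w f].
Proof.
move=> lt spec; split=> [[j /hear_sound[w [w1 w2 w3]]]|[w [j [w1 jk jt fa]]]].
  exists w, j; split=> //; first by rewrite -ltnS.
  by apply/spec; rewrite ?leq_subr // -mem_emit // (leq_ltn_trans (leq_subr _ _) lt).
exists (Ordinal (jk : j < k.+1)).
have := @hear_from (t - j) w v (Ordinal (jk : j < k.+1)) (PFact f).
rewrite /= subnK //; apply=> //.
by apply/spec; rewrite ?leq_subr.
Qed.

(* The synchronization argument: the facts of stage i + 1 emitted in the ball of
   v are heard by v after its evaluation of stage i + 1 and no later than that
   of stage i + 2, because starting times differ by at most the distance. *)
Lemma store_at_evaluation t i v : t < t1 -> t = tS + distr v + i * per ->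
  (forall s u f, s <= t -> PFact f \in npend (st s u) <-> fact_at s u f) ->
  store_now (st t v) (ml t v) = store_spec phi i v.
Proof.
move=> lt et spec; apply/setP=> f; apply/idP/idP.
  case/(mem_store_now _ _ lt) => s [j [ls h]].
  have /(hear_fact v (leq_ltn_trans ls lt)) : exists j, (j, PFact f) \in hear s v.
    by exists j.
  case=> [s' u ls'|w [j' [wk jk js [i' [b [es ef hb]]]]]].
    by apply: spec; apply: leq_trans ls.
  have dv := dist_walk (@adj_connected C k D N) r wk.
  (* The fact left w one round after its evaluation and travelled j' rounds, while v started at most
     j' rounds after w; so it stems from an earlier evaluation number. *)
  have ii : i' < i.
    rewrite -(@ltn_pmul2r per) //; lia.
  rewrite ef inE; apply/existsP; exists (w, b); rewrite eqxx andbT /=.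
  apply/andP; split.
    by move: hb; rewrite inE => /andP[_ hb]; apply: (subsetP (stage_sub _ _ ii)).
  by rewrite (ball_sym symN); apply/ballP; exists j'.
rewrite inE => /existsP[[w b] /and3P[/= hb wv /eqP ->]].
have [i' ii hb'] := first_stage hb.
move: wv; rewrite (ball_sym symN) => /ballP[j jk wk].
have wk' : walk adjN j v w by rewrite (walk_sym symN).
have dw := dist_walk (@adj_connected C k D N) r wk'.
have le_i : i'.+1 * per <= i * per by rewrite leq_mul2r ii orbT.
pose s := (tS + distr w + i' * per).+1.
(* w starts at most j rounds after v, and the fact needs one round to be emitted and j to travel: at
   most 2k + 1 rounds, one period. *)
have le_s : s + j <= t by rewrite /s; move: le_i; rewrite et /period; lia.
apply/(mem_store_now _ _ lt).
have ltj : s + j < t1 by apply: leq_ltn_trans lt.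
have : exists j', (j', PFact (labelN w, map_tuple labelN b)) \in hear (s + j) v.
  apply/(hear_fact v ltj).
    by move=> s' u ls'; apply: spec; apply: leq_trans le_s.
  exists w, j; split=> //; first exact: leq_addl.
  by rewrite addnK; exists i', b.
by case=> j' hj; exists (s + j), j'.
Qed.

(** Strong induction on time: what is pending at t + 1 depends on the store at t, hence on the facts
    emitted up to t, to which [store_at_evaluation] applies. *)
Lemma fact_spec t v f : t <= t1 -> PFact f \in npend (st t v) <-> fact_at t v f.
Proof.
elim/ltn_ind: t v f => -[|t] IH v f lt.
  rewrite st_init /=; split=> [|[i [b []]] //].
  by case: (v == r); rewrite !inE.
have spec s u g : s <= t -> PFact g \in npend (st s u) <-> fact_at s u g.
  by move=> ls; apply: IH => //; apply: leq_trans ls (ltnW lt).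
rewrite running_st //= inE lab_st /new_facts.
case: (clock0P v (ltnW lt)) => [[i et]|no]; last first.
  rewrite inE andbF; split=> // -[i [b [[et] _ _]]].
  by case: no; exists i.
have tt : tS <= t <= t1 by rewrite (ltnW lt) et -addnA leq_addr.
rewrite lab_st (near_exact v tt) (adj_exact v tt) (store_at_evaluation lt et spec).
rewrite inE; split=> [/andP[/eqP e1 /new_tuples[b hb e2]]|[i' [b [[et'] -> hb]]]].
  exists i, b; split=> //; first by rewrite -et.
  by rewrite e2 -e1; case: (f).
rewrite eqxx; apply/new_tuples; exists b => //=.
suff -> : i = i' by [].
apply/eqP; rewrite -(@eqn_pmul2r per) //; apply/eqP; lia.
Qed.

Lemma fact_at_bounded t v f : fact_at t v f -> t < tS + #|N| + lastN * per + 2.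
Proof.
case=> i [b [-> _ hb]]; have dv := dist_lt_card (@adj_connected C k D N) r v.
have ii : i <= lastN.
  rewrite leqNgt; apply/negP=> gt; move: hb.
  by rewrite !stage_stable ?setDv ?inE // ltnW // ltnW.
have : i * per <= lastN * per by rewrite leq_mul2r ii orbT.
move: (lastN * per) (i * per) dv => X Y; lia.
Qed.

(** Here the choice of [hmax] pays off: [#|N| * hm] covers the starting delays, all the stages and
    the last flood. *)
Lemma quiet_time : tS + #|N| + lastN * per + 2 + k < t1.
Proof.
apply: leq_ltn_trans (tl_long tl).
have -> : #|N| * hm = lastN * per + #|N| * per + #|N| * (3 * k) + #|N| * 3.
  by rewrite /hmax; lia.
have n0 : 0 < #|N| by apply/card_gt0P; exists r.
have e2 : #|N| <= #|N| * per by rewrite leq_pmulr.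
have e3 : 3 * k <= #|N| * (3 * k) by rewrite leq_pmull.
have e4 : 3 <= #|N| * 3 by rewrite leq_pmull.
move: (lastN * per) (#|N| * per) (#|N| * (3 * k)) (#|N| * 3) e2 e3 e4.
by move=> X Y W U; lia.
Qed.

Lemma fact_heard_bounded t v f j : t < t1 -> (j, PFact f) \in hear t v ->
  t < tS + #|N| + lastN * per + 2 + k.
Proof.
move=> lt h; have /(hear_fact v lt) : exists j, (j, PFact f) \in hear t v.
  by exists j.
case=> [s u ls|w [j' [_ jk jt /fact_at_bounded]]]; last by lia.
by apply: fact_spec; apply: leq_trans ls (ltnW lt).
Qed.

Lemma final_store v : nstore (st t1 v) = store_spec phi lastN v.
Proof.
apply/setP=> f; apply/idP/idP.
  case/(mem_store v f (leqnn _)) => s [j [ls h]].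
  have /(hear_fact v ls) : exists j, (j, PFact f) \in hear s v by exists j.
  case=> [s' u ls'|w [j' [wk jk js [i [b [es -> hb]]]]]].
    by apply: fact_spec; apply: leq_trans ls' (ltnW ls).
  rewrite inE; apply/existsP; exists (w, b); rewrite eqxx andbT /=.
  apply/andP; split; last by rewrite (ball_sym symN); apply/ballP; exists j'.
  move: hb; rewrite inE => /andP[_ hb]; case: (leqP lastN i.+1) => le.
    by rewrite -(stage_stable phi le).
  by apply: (subsetP (stage_sub _ _ (ltnW le))).
rewrite inE => /existsP[[w b] /and3P[/= hb wv /eqP ->]].
have [i ii hb'] := first_stage hb.
move: wv; rewrite (ball_sym symN) => /ballP[j jk wk].
pose s := (tS + distr w + i * per).+1.
have fs : fact_at s w (labelN w, map_tuple labelN b) by exists i, b.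
have ltj : s + j < t1 by have := quiet_time; have := fact_at_bounded fs; lia.
apply/(mem_store v _ (leqnn _)).
have : exists j', (j', PFact (labelN w, map_tuple labelN b)) \in hear (s + j) v.
  apply/(hear_fact v ltj).
    by move=> s' u ls'; apply: fact_spec; apply: leq_trans ls' (ltnW ltj).
  by exists w, j; split; rewrite ?addnK ?leq_addl.
by case=> j' hj; exists (s + j), j'.
Qed.

(** * Termination *)

(** While the halt signal spreads, some nodes still run; with no token and no fact in circulation,
    their stores stay final. Two conditions are restricted to running nodes because r keeps the
    token in its halted state. *)
Definition quiet_inv (t : nat) : Prop := forall v,
  [/\ [/\ nstore (st t v) = store_spec phi lastN v,
          nnear (st t v) = near_spec v & nadj (st t v) = adj_spec v],
      ~~ nhalt (st t v) -> nhold (st t v) = None,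
      ~~ nhalt (st t v) -> forall f, PFact f \notin npend (st t v),
      forall i b, ITok b \notin out t v i
    & forall i j f, IPkt (j, PFact f) \notin out t v i].

Lemma quiet_inv_t1 : quiet_inv t1.
Proof.
have qt := quiet_time; have ltS := tS_lt_t1.
move=> v; split.
- by rewrite final_store near_exact ?adj_exact // leqnn ltnW.
- by rewrite (tl_halt tl) => vr; apply: (tl_token tl).
- move=> _ f; apply/negP=> /(fact_spec v f (leqnn _))/fact_at_bounded; lia.
- exact: (tl_token_out tl).
have t0 : 0 < t1 by lia.
have lt : t1.-1 < t1 by rewrite prednK.
move=> i j f; rewrite -(prednK t0) running_out // ffunE inE /=.
apply/negP=> /andP[_ h].
have hh : (inord j.-1, PFact f) \in hear t1.-1 v.
  by rewrite /hear (negbTE (tl_running tl v lt)).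
have := fact_heard_bounded lt hh; lia.
Qed.

Lemma quiet_inv_step t : quiet_inv t -> quiet_inv t.+1.
Proof.
move=> qi v; have [[q1 q2 q3] q4 q5 _ _] := qi v.
rewrite stS outS; case: (boolP (nhalt (st t v))) => [hv|nh].
  by rewrite hv; split=> // i *; rewrite ffunE inE.
have ar : arrival (st t v) (ml t v) = None.
  by apply: no_arrival => u i b; case: (qi u).
have nf j f : (j, PFact f) \notin heard_of (st t v) (ml t v).
  rewrite inE negb_or /=; apply/andP; split.
    by rewrite negb_and q5 ?orbT.
  by rewrite no_got // => u i; case: (qi u).
have nhs f : hears (st t v) (ml t v) (PFact f) = false.
  by apply/existsP=> -[j]; apply/negP.
have sn : store_now (st t v) (ml t v) = store_spec phi lastN v.
  rewrite /store_now q1 -[RHS]setU0; congr (_ :|: _).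
  by apply/setP=> f; rewrite !inE nhs.
rewrite /= q4 //; split=> //.
- by move=> _; rewrite /next_hold q4 // ar.
(* Clocks still trigger evaluations, but the store is that of the fixpoint, so nothing new is
   found. *)
- move=> _ f; rewrite inE lab_st /new_facts; case: ifP => _; last by rewrite inE andbF.
  rewrite sn lab_st q2 q3; apply/negP=> /andP[_]; rewrite inE => /new_tuples[b].
  by rewrite stage_stable ?leqnSn // setDv inE.
- by move=> i b; rewrite ffunE inE /send q4.
- by move=> i j f; rewrite ffunE inE /= (negbTE (nf _ _)) andbF.
Qed.

Lemma quiet_inv_all d : quiet_inv (t1 + d).
Proof.
elim: d => [|d IH]; first by rewrite addn0; apply: quiet_inv_t1.
by rewrite addnS; apply: quiet_inv_step.
Qed.

Lemma halt_spec d v : nhalt (st (t1 + d) v) = (distr v <= d)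
  /\ forall i, (IHalt \in out (t1 + d) v i) = (distr v == d).
Proof.
elim: d v => [|d IH] v.
  rewrite addn0 (tl_halt tl) leqn0 dist_eq0 eq_sym; split=> // i.
  by rewrite (tl_halt_out tl).
rewrite addnS stS outS; have [hv _] := IH v; rewrite hv.
have [le|le] := leqP (distr v) d.
  split=> [|i]; first by rewrite hv le leqW.
  by rewrite ffunE inE; apply/esym/eqP; lia.
have ha : halt_now (st (t1 + d) v) (ml (t1 + d) v) = (distr v == d.+1).
  rewrite /halt_now /finish (_ : nhold _ = None) /=.
    by apply: flood_next => // u i; case: (IH u).
  have [_ q4 _ _ _] := quiet_inv_all d v.
  by apply: q4; case: (IH v) => -> _; rewrite -ltnNge.
split=> [|i]; last by rewrite ffunE inE.
by rewrite /= ha eqn_leq le andbT.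
Qed.

Lemma terminated : exists T, [/\ T <= (2 * D.+1 * hm.+2).+1 * #|N|,
  forall v, nhalt (st T v) & forall v, nstore (st T v) = store_spec phi lastN v].
Proof.
exists (t1 + #|N|); split.
- by rewrite mulSn addnC leq_add2l (tl_bound tl).
- by move=> v; have [-> _] := halt_spec #|N| v; apply: ltnW; apply: dist_lt_card.
by move=> v; case: (quiet_inv_all #|N| v) => -[].
Qed.

(** * Message counting *)

(** Kinds 0, 1, 2 are the successive reactions to an activation, each caused by hearing the previous
    kind; facts are counted separately. *)
Definition kind (p : pay) : nat :=
  match p with PAct => 0 | PBall _ => 1 | PNear _ | PAdj _ => 2 | PFact _ => 3 end.

Definition emits (c t : nat) (v : N) : bool := [exists p in emit t v, kind p == c].

Definition hears_kind (c t : nat) (v : N) : bool :=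
  [exists x in hear t v, kind x.2 == c].

Lemma sum_shift (Q : nat -> bool) j T :
  \sum_(t < T) ((j <= t) && Q (t - j) : nat) <= \sum_(t < T) (Q t : nat).
Proof.
have -> : \sum_(t < T) ((j <= t) && Q (t - j) : nat) = \sum_(t < T - j) (Q t : nat).
  elim: T => [|T IH]; first by rewrite sub0n !big_ord0.
  rewrite big_ord_recr /= IH; case: leqP => jT /=.
    by rewrite subSn // big_ord_recr.
  have [-> ->] : T - j = 0 /\ T.+1 - j = 0 by lia.
  by rewrite big_ord0.
rewrite -!(big_mkord xpredT (fun t => Q t : nat)).
by rewrite [leqRHS](big_cat_nat (n := T - j)) ?leq_subr //= leq_addr.
Qed.

(** Whatever v hears was emitted in its ball at most k rounds before. The ball has at most [#|C|]
    nodes because its labels are distinct, and there are k + 1 possible delays. *)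
Lemma hear_count c v T E : (forall w, \sum_(t < T) (emits c t w : nat) <= E) ->
  \sum_(t < T) (hears_kind c t v : nat) <= #|C| * (k.+1 * E).
Proof.
move=> hE; pose S t := \sum_(w in ballN v) \sum_(j < k.+1)
  ((j <= t) && emits c (t - j) w : nat).
apply: (@leq_trans (\sum_(t < T) S t)).
  apply: leq_sum => t _; case: (boolP (hears_kind _ _ _)) => // /existsP[[j p]].
  case/andP=> /hear_sound[w [w1 w2 w3]] kp; rewrite /S.
  have wb : w \in ballN v.
    by rewrite (ball_sym symN); apply/ballP; exists j; rewrite // -ltnS.
  have em : emits c (t - j) w by apply/existsP; exists p; rewrite w3.
  by rewrite (bigD1 w) //= (bigD1 j) //= w2 em.
rewrite exchange_big /=; apply: (@leq_trans (\sum_(w in ballN v) (k.+1 * E))).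
  apply: leq_sum => w _; rewrite exchange_big /=.
  apply: (@leq_trans (\sum_(j < k.+1) E)); last by rewrite sum_nat_const card_ord.
  by apply: leq_sum => j _; apply: leq_trans (sum_shift (fun t => emits c t w) j T) (hE w).
by rewrite sum_nat_const leq_mul2r card_ball orbT.
Qed.

Lemma sum_bool_prev (Q R : nat -> bool) T : Q 0 = false ->
  (forall t, Q t.+1 -> R t) ->
  \sum_(t < T) (Q t : nat) <= \sum_(t < T) (R t : nat).
Proof.
move=> Q0 QR; case: T => [|T]; first by rewrite !big_ord0.
rewrite big_ord_recl Q0 big_ord_recr /= add0n; apply: leq_trans (leq_addr _ _).
by apply: leq_sum => t _; have := QR t; rewrite /bump add1n; case: (Q _.+1) => // ->.
Qed.

Lemma emits_init c v : emits c.+1 0 v = false.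
Proof. by apply/existsP=> -[p /andP[/emit0 ->]]. Qed.

Lemma emits_ball t v : emits 1 t.+1 v -> hears_kind 0 t v.
Proof.
case/existsP=> -[|c|x|x|x] /andP[] //= /emit_ballP[s [j [[->] _ h]]] _.
by apply/existsP; exists (j, PAct); rewrite h.
Qed.

Lemma emits_near t v : emits 2 t.+1 v -> hears_kind 1 t v.
Proof.
case/existsP=> -[|c|x|x|x] /andP[] //= => [/emit_nearP|/emit_adjP].
  by case=> s [j [[->] _ h]] _; apply/existsP; exists (j, PBall x.1); rewrite h.
by case=> s [j [[->] _ _ h]] _; apply/existsP; exists (j, PBall x.1); rewrite h.
Qed.

(** A potential that never decreases and grows with each activation: an arrival adds a holder, the
    restart at r adds a clock, and a departure trades the holder for a used port. *)
Definition token_pot (s : nstate C k D l) : nat :=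
  #|nused s false| + #|nused s true| + (nhold s : bool) + (nclock s : bool).

Lemma next_usedE (s : nstate C k D l) : 
  #|next_used s false| + #|next_used s true|
  = #|nused s false| + #|nused s true| + (send s : bool).
Proof.
rewrite !ffunE /send; case: nhold => [[b q]|]; last by rewrite addn0.
case: (q == ord_max); last by rewrite addn0.
rewrite /nport; case e: tarry_port => [i|] /=; last by rewrite addn0.
have [_ iu _] := tarry_port_some e.
by case: b iu {e} => iu; rewrite /= cardsU1 iu /= addn1 add1n ?addnS ?addSn.
Qed.

Lemma token_pot_step s m :
  emits_act s m + token_pot s <= token_pot (next_state phi s m).
Proof.
rewrite /token_pot /= next_usedE /send /emits_act /next_clock /start_now.
rewrite /next_hold /arrival /finish; case: nhold => [[b q]|] /=.
  case: (q == ord_max) => /=; last by case: nclock => /=; lia.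
  by case: nport => [i|] /=; case: nclock => /=; lia.
by case: pickP => [x|] /=; case: nclock => /=; lia.
Qed.

Lemma token_pot_max t v : token_pot (st t v) <= D + D + 2.
Proof.
have c b : #|nused (st t v) b| <= D by rewrite -[leqRHS]card_ord max_card.
have := c true; have := c false; rewrite /token_pot.
case: (isSome _); case: (isSome _) => /=; lia.
Qed.

Lemma emits_act_count v T : \sum_(t < T) (emits 0 t v : nat) <= D + D + 2.
Proof.
have eE t : emits 0 t v = (PAct \in emit t v).
  apply/existsP/idP => [[[|c|x|x|x] /andP[] //]|h].
  by exists PAct; rewrite h.
apply: leq_trans (token_pot_max T v).
suff : \sum_(t < T.+1) (emits 0 t v : nat) <= token_pot (st T v).
  by rewrite big_ord_recr /=; lia.
elim: T => [|T IH].
  rewrite big_ord_recl big_ord0 eE /emit st_init /token_pot /=.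
  by rewrite !ffunE !cards0; case: (v == r); rewrite !inE ?eqxx.
rewrite big_ord_recr /= eE /emit stS.
case: (boolP (nhalt (st T v))) => [->|_]; first by rewrite inE addn0.
apply: leq_trans (token_pot_step (st T v) (ml T v)).
by rewrite addnC leq_add //; case: ifP => _; rewrite !inE.
Qed.

(** The tuples stored or pending at v form a growing set, and each emission strictly enlarges it,
    since new facts are taken outside the store that already includes the pending ones. *)
Lemma emits_fact_count v T :
  \sum_(t < T) (emits 3 t v : nat) <= #|{: l.-tuple C}|.
Proof.
pose facts t := [set g | ((labelN v, g) \in nstore (st t v))
                         || (PFact (labelN v, g) \in npend (st t v))].
apply: leq_trans (max_card (mem (facts T))).
suff : \sum_(t < T.+1) (emits 3 t v : nat) <= #|facts T|.
  by rewrite big_ord_recr => h; apply: leq_trans h; apply: leq_addr.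
elim: T => [|T IH]; first by rewrite big_ord_recl big_ord0 emits_init.
rewrite big_ord_recr /=; apply: leq_trans (leq_add IH (leqnn _)) _.
have [hv|nh] := boolP (nhalt (st T v)).
  have -> : facts T.+1 = facts T by apply/setP=> g; rewrite !inE stS hv.
  rewrite (_ : emits _ _ _ = false) ?addn0 //.
  by apply/existsP=> -[p]; rewrite /emit stS hv hv inE.
have sub : facts T \subset facts T.+1.
  apply/subsetP=> g; rewrite !inE stS (negbTE nh) /= !inE.
  case/orP=> [->//|h]; apply/orP; left; apply/orP; right.
  by apply/existsP; exists ord0; rewrite inE /= h.
case: (boolP (emits 3 T.+1 v)) => [/existsP[p /andP[]]|_]; last first.
  by rewrite addn0 subset_leq_card.
case: p => // -[c g] /mem_emitS[_]; rewrite inE /= lab_st => /andP[_ hg] _.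
rewrite addn1; apply: proper_card; rewrite properE sub; apply/subsetPn.
exists g; first by rewrite inE stS (negbTE nh) /= [X in _ || X]inE /= lab_st eqxx hg orbT.
move: hg; rewrite /new_facts; case: ifP => _; rewrite inE // => /andP[_].
rewrite lab_st !inE !negb_or => /andP[-> /existsPn no] /=.
by have := no ord0; rewrite inE /= negb_or => /andP[].
Qed.

Definition signals (t : nat) (v : N) : nat :=
  if nhalt (st t v) then 0
  else (send (st t v) : bool) + start_now (st t v) (ml t v)
       + halt_now (st t v) (ml t v).

(** Each signal leaves a permanent trace: the token uses a new port, a start sets the clock, a halt
    stops the node. *)
Lemma signals_count v T : \sum_(t < T) signals t v <= D + D + 2.
Proof.
pose pot (s : nstate C k D l) :=
  #|nused s false| + #|nused s true| + (nclock s : bool) + nhalt s.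
have pot_max : pot (st T v) <= D + D + 2.
  have c b : #|nused (st T v) b| <= D by rewrite -[leqRHS]card_ord max_card.
  have := c true; have := c false; rewrite /pot.
  by case: (isSome _); case: (nhalt _) => /=; lia.
apply: leq_trans pot_max; elim: T => [|T IH]; first by rewrite big_ord0.
rewrite big_ord_recr /= /signals stS.
case: (boolP (nhalt (st T v))) => [_|nh]; first by rewrite addn0.
apply: leq_trans (leq_add IH (leqnn _)) _.
rewrite /pot /= (negbTE nh) next_usedE /next_clock /start_now.
by case: nclock => [c|] /=; [|case: (_ || _)]; rewrite /=; lia.
Qed.

Lemma sent_reason t v i : out t.+1 v i != set0 ->
  0 < hears_kind 0 t v + hears_kind 1 t v + hears_kind 2 t v
      + hears_kind 3 t v + signals t v.
Proof.
rewrite outS /signals; case: (boolP (nhalt _)) => nh; first by rewrite ffunE eqxx.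
case/set0Pn=> f; rewrite ffunE inE; case: f => [[j p] /andP[_ h]|b h|h|h].
- have hk : hears_kind (kind p) t v.
    by apply/existsP; exists (inord j.-1, p); rewrite /hear (negbTE nh) eqxx andbT; apply: h.
  by case: p {h} hk => [|c|x|x|x] /= ->; lia.
- by rewrite (eqP h) /=; lia.
- by rewrite h; lia.
- by rewrite h; lia.
Qed.

Definition flood_cost (E : nat) : nat := #|C| * (k.+1 * E).

(** The summands pay for activations, labels, pairs, facts and signals; each round with a reason to
    send costs at most D messages. *)
Definition node_cost : nat :=
  let E0 := D + D + 2 in
  D * (flood_cost E0 + flood_cost (flood_cost E0)
       + flood_cost (flood_cost (flood_cost E0))
       + flood_cost #|{: l.-tuple C}| + E0).

Lemma out_count v T :
  \sum_(t < T) \sum_(i < D) (out t.+1 v i != set0 : nat) <= node_cost.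
Proof.
pose R t := hears_kind 0 t v + hears_kind 1 t v + hears_kind 2 t v
            + hears_kind 3 t v + signals t v.
apply: (@leq_trans (\sum_(t < T) D * R t)).
  apply: leq_sum => t _; rewrite -[X in X * _]card_ord -sum_nat_const.
  by apply: leq_sum => i _; case: eqP => //= /eqP; apply: sent_reason.
rewrite -big_distrr /= leq_mul2l; apply/orP; right.
have E1 w : \sum_(t < T) (emits 1 t w : nat) <= flood_cost (D + D + 2).
  apply: leq_trans (hear_count w (fun u => emits_act_count u T)).
  apply: (@sum_bool_prev (emits 1 ^~ w) (hears_kind 0 ^~ w)) => [|t].
    exact: emits_init.
  exact: emits_ball.
have E2 w : \sum_(t < T) (emits 2 t w : nat) <= flood_cost (flood_cost (D + D + 2)).
  apply: leq_trans (hear_count w E1).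
  apply: (@sum_bool_prev (emits 2 ^~ w) (hears_kind 1 ^~ w)) => [|t].
    exact: emits_init.
  exact: emits_near.
rewrite !big_split /=; do 4?[apply: leq_add].
- exact: hear_count (fun u => emits_act_count u T).
- exact: hear_count E1.
- exact: hear_count E2.
- exact: hear_count (fun u => emits_fact_count u T).
- exact: signals_count.
Qed.

End Execution.

(** * The compiled protocol and its complexity bounds *)

Theorem theorem11 (C : finType) (k D l : nat) (phi : formula l (option 'I_l)) :
  exists (M : machine C D l) (in_time dist_time msg_size msg_node : nat),
    forall (N : network C k D) (P : port_numbering N) (r : N),
    exists (x : nat -> N -> conf M) (steps : nat -> N -> nat) (T : nat),
      execution P r x steps /\
      (forall a : N, halted (x T a) /\ correct_answer phi a (x T a)) /\
      (forall (t : nat) (a : N), steps t a <= in_time) /\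
      T <= dist_time * #|N| /\
      (forall (t : nat) (a : N) (i : 'I_D),
         size (outbox (x t a) i) <= msg_size) /\
      (forall a : N, messages_sent x T a <= msg_node).
Proof.
pose A := fixpoint_protocol C k D phi.
(* The witnesses are chosen before the network. The time constant covers two traversals with turns
   of [hmax + 2] rounds, and one more [#|N|] for the spread of the halt signal. *)
exists (compiled A), (round_steps A), (2 * D.+1 * (hmax C k l).+2).+1,
  #|pitem A|, (node_cost C k D l) => N P r.
have iq c nb : pstep (pinit A c nb false) (quiet D _)
    = (pinit A c nb false, quiet D _) by apply: init_quiet.
have ir c nb b : ~~ phalt (pinit A c nb b) by [].
have [x [steps [ex hx ax sx ox]]] := compile_execution iq ir P r.
have [tS [t1 tl]] := timeline_exists phi P r.
have [T [Tle Th Ts]] := terminated tl.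
exists x, steps, T; split=> //; split; [|split; [exact: sx|split; [exact: Tle|split]]].
- move=> a; have ha : phalt (prun P A r T a).1 by apply: Th.
  split=> [|c]; first by rewrite hx.
  rewrite ax // inE -/(st phi P r T a) lab_st Ts mem_own_store.
  split=> [[b hb e]|[b [hb e]]]; exists b => //.
    by split=> //; apply/in_fixpointE.
  exact/in_fixpointE.
- by move=> t a i; case: (ox t a i).
move=> a; apply: leq_trans (out_count phi P r a T).
by apply: leq_sum => t _; apply: leq_sum => i _; case: (ox t.+1 a i) => _ ->.
Qed.
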